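(* Let $q=p^n$ be an odd prime power ($p$ prime, $n\ge 1$), let $\chi$ be a generator of the cyclic group $\widehat{\mathbb{F}_q^{\times}}$ of multiplicative characters of $\mathbb{F}_q$, and let $1\le r\le q-2$ be an integer. For a divisor $1<k<q-1$ of $q-1$, let $a_1,\dots,a_{(q-1)/k}$ be the distinct elements of $D_k=\{x^k: x\in\mathbb{F}_q^{\times}\}$ (in any fixed order), and define the complex matrix $$B_{q,k}(\chi^r):=\left[\chi^r(a_i+a_j)+\chi^r(a_i-a_j)\right]_{1\le i,j\le (q-1)/k}.$$ Then: (i) If $q\equiv 3\pmod 4$, then $$\det (B_{q,2}(\chi^r))=\prod_{0\le k\le (q-3)/2}J_q(\chi^r,\chi^{2k})= \begin{cases} (-1)^{\frac{q-3}{4}}\,\mathbf{i}^n\,G_q(\chi^r)^{\frac{q-1}{2}}/\sqrt{q} & \text{if } r\equiv 1\pmod 2,\\ G_q(\chi^r)^{\frac{q-1}{2}}/q & \text{if } r\equiv 0\pmod 2. \end{cases}$$ (ii) For any divisor $1<k<q-1$ of $q-1$ with $(q-1)/k\equiv 0\pmod 2$, the matrix $B_{q,k}(\chi^r)$ is singular.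
   Context: Every multiplicative character $\psi$ of $\mathbb{F}_q$ is extended to $\mathbb{F}_q$ by $\psi(0)=0$ (including the trivial character). For characters $A,B$, the Jacobi sum is $J_q(A,B)=\sum_{x\in\mathbb{F}_q}A(x)B(1-x)$. The Gauss sum is $G_q(A)=\sum_{x\in\mathbb{F}_q}A(x)\zeta_p^{\mathrm{Tr}(x)}$, where $\zeta_p=e^{2\pi \mathbf{i}/p}$, $\mathbf{i}=e^{\pi\mathbf{i}/2}$ is the primitive fourth root of unity with argument $\pi/2$, and $\mathrm{Tr}(x)=\sum_{j=0}^{n-1}x^{p^j}$ is the trace from $\mathbb{F}_q$ to $\mathbb{F}_p$. Here $\sqrt{q}$ denotes the positive square root and $\chi^0$ is the trivial character. *)

(* Defs.v *)
From HB Require Import structures.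
From mathcomp Require Import all_boot all_order all_algebra all_field.
From mathcomp Require Import all_classical all_reals all_analysis.
From mathcomp Require Import complex.

Set Implicit Arguments.
Unset Strict Implicit.
Unset Printing Implicit Defensive.

Import Order.TTheory GRing.Theory Num.Theory.
Local Open Scope ring_scope.
Local Open Scope complex_scope.

Definition is_mchar (F : finFieldType) (C : fieldType) (psi : F -> C) : Prop :=
  [/\ psi 0 = 0, psi 1 = 1 & forall x y : F, psi (x * y) = psi x * psi y].

(* psi^r, extended by 0 at 0 (so psi^0 is the trivial character with
   psi^0(0) = 0). *)
Definition mchar_pow (F : finFieldType) (C : fieldType) (psi : F -> C)
  (r : nat) : F -> C :=
  fun x => if x == 0 then 0 else psi x ^+ r.

Definition is_mchar_generator (F : finFieldType) (C : fieldType)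
  (chi : F -> C) : Prop :=
  is_mchar chi /\
  forall psi : F -> C, is_mchar psi -> exists k : nat, psi =1 mchar_pow chi k.

Definition jacobi (F : finFieldType) (C : fieldType) (A B : F -> C) : C :=
  \sum_(x : F) A x * B (1 - x).

Definition ftrace (F : finFieldType) (p n : nat) (x : F) : F :=
  \sum_(j < n) x ^+ (p ^ j).

Definition zeta_p (R : realType) (p : nat) : R[i] :=
  cos (2 * pi / p%:R) +i* sin (2 * pi / p%:R).

(* zeta_p ^ Tr(x): Tr(x) lies in the prime field F_p = {m%:R | m < p},
   and we take the exponent m < p with m%:R = Tr(x). *)
Definition addchar (R : realType) (F : finFieldType) (p n : nat) (x : F)
  : R[i] :=
  oapp (fun m : 'I_p => zeta_p R p ^+ m) 0
       [pick m : 'I_p | (m%:R : F) == ftrace p n x].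

Definition gauss (R : realType) (F : finFieldType) (p n : nat)
  (A : F -> R[i]) : R[i] :=
  \sum_(x : F) A x * addchar R p n x.

Definition Dset (F : finFieldType) (k : nat) : {set F} :=
  [set x ^+ k | x in [set y : F | y != 0]].

Definition Bmat (F : finFieldType) (C : fieldType) (m : nat)
  (psi : F -> C) (a : 'I_m -> F) : 'M[C]_m :=
  \matrix_(i < m, j < m) (psi (a i + a j) + psi (a i - a j)).

(* Main.v *)
(** Write [psi = chi^r].  Factoring [psi(a_i)] out of row [i] (the product of
    all nonzero squares is 1 when [(q-1)/2] is odd) turns the matrix into the
    group matrix of [f(t) = psi(1+t) + psi(1-t)] on the group of squares; the
    characters [chi^(2k)] diagonalise it, and as -1 is not a square the
    eigenvalues are the Jacobi sums [J(psi, chi^(2k))].  These are quotients of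
    Gauss sums, which cancel in pairs up to [G(phi)], [phi] the quadratic
    character.  When [-1] lies in [D_k] the matrix has two equal columns.

    To get [G(phi) = i^n sqrt q] for [n = 2h+1], let [g] generate the field, with
    conjugates [g_j = g^(p^j)], and let [y = prod_(0<j<n) (g - g_j)].  By
    Lagrange interpolation [Tr(g^k / y)] is 0 for [k < n-1] and 1 for [k = n-1],
    so the span [W] of [1, .., g^(h-1)] is isotropic for [Tr(x^2/y)], and summing
    over the cosets of [W] reduces [sum_x e(x^2/y) = phi(y) G(phi)] to a positive
    multiple of the Gauss sum over F_p, while [phi(y) = (-1)^h].  Over F_p, the
    alternating sum of the Gaussian binomials [p-1 choose k] (Gauss's original
    argument) writes the sum as a product of sines whose signs are known.  This
    fixes the argument of [G(phi)]; its square is [phi(-1) q = -q]. *)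
Require Import Defs.
From HB Require Import structures.
From mathcomp Require Import all_boot all_order all_algebra all_field.
From mathcomp Require Import all_classical all_reals all_analysis.
From mathcomp Require Import cyclic complex.
From mathcomp Require Import ring lra zify.
Import Order.TTheory GRing.Theory Num.Theory.
Local Open Scope ring_scope.
Local Open Scope complex_scope.

Set Implicit Arguments.
Unset Strict Implicit.
Unset Printing Implicit Defensive.

(** * Multiplicative characters, Gauss sums and Jacobi sums *)

Lemma finField_prim_root (F : finFieldType) :
  exists g : F, (#|F|.-1).-primitive_root g.
Proof.
have N0 : (0 < #|F|.-1)%N by rewrite -ltnS prednK ?finNzRing_gt1 // ltnW
  ?finNzRing_gt1.
have card_pos : #|F| = #|F|.-1.+1 by rewrite prednK // ltnW ?finNzRing_gt1.
have := @has_prim_root F #|F|.-1 (enum (predC1 (0 : F))) N0.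
case/(_ _ _ _)/hasP.
- apply/allP => x; rewrite mem_enum inE unity_rootE => x0.
  by apply/eqP/(mulfI x0); rewrite -exprS -card_pos expf_card mulr1.
- exact: enum_uniq.
- by rewrite -cardE cardC1.
by move=> g _ gP; exists g.
Qed.

Lemma finField_prim_rootP (F : finFieldType) (g x : F) :
  (#|F|.-1).-primitive_root g -> x != 0 -> exists i, x = g ^+ i.
Proof.
move=> gP x0; have /(prim_rootP gP) [i ->] : x ^+ #|F|.-1 = 1.
  apply/(mulfI x0); rewrite -exprS prednK ?expf_card ?mulr1 //.
  by rewrite ltnW ?finNzRing_gt1.
by exists i.
Qed.

Lemma prim_root_neq0 (F : finFieldType) (g : F) :
  (#|F|.-1).-primitive_root g -> g != 0.
Proof.
move=> gP; apply/eqP => g0; have := prim_expr_order gP.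
rewrite g0 expr0n gtn_eqF ?(prim_order_gt0 gP) // => /eqP.
by rewrite eq_sym oner_eq0.
Qed.

Section MulChar.
Variables (F : finFieldType) (C : fieldType) (psi : F -> C).
Hypothesis psiP : is_mchar psi.

Lemma mchar0 : psi 0 = 0. Proof. by case: psiP. Qed.
Lemma mchar1 : psi 1 = 1. Proof. by case: psiP. Qed.
Lemma mcharM x y : psi (x * y) = psi x * psi y. Proof. by case: psiP. Qed.

Lemma mcharX x k : psi (x ^+ k) = psi x ^+ k.
Proof. by elim: k => [|k IH]; rewrite ?mchar1 // !exprS mcharM IH. Qed.

Lemma mchar_neq0 x : x != 0 -> psi x != 0.
Proof.
move=> x0; apply/eqP => px0; move/eqP: (oner_neq0 C); apply.
by rewrite -mchar1 -(divff x0) mcharM px0 mul0r.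
Qed.

Lemma mcharV x : psi x^-1 = (psi x)^-1.
Proof.
have [->|x0] := eqVneq x 0; first by rewrite invr0 mchar0 invr0.
by apply: (mulfI (mchar_neq0 x0)); rewrite -mcharM !divff ?mchar1 ?mchar_neq0.
Qed.

Lemma mcharN1_sqr : psi (-1) ^+ 2 = 1.
Proof. by rewrite -mcharX sqrrN expr1n mchar1. Qed.

(** Multiplication by [a] with [psi a != 1] permutes the field and scales the sum by [psi a]. *)
Lemma mchar_sum0 : (exists2 x, x != 0 & psi x != 1) -> \sum_x psi x = 0.
Proof.
case=> a a0 pa1; have d0 : 1 - psi a != 0 by rewrite subr_eq0 eq_sym.
apply: (mulfI d0); rewrite mulr0; apply/eqP.
rewrite mulrBl mul1r subr_eq0 mulr_sumr; apply/eqP.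
rewrite [LHS](reindex_onto (fun x => a * x) (fun x => a^-1 * x)) /=; last first.
  by move=> x _; rewrite mulVKf.
by apply: eq_big => [x|x _]; rewrite ?mulKf ?eqxx ?mcharM.
Qed.

End MulChar.

Lemma mchar_powP (F : finFieldType) (C : fieldType) (psi : F -> C) k :
  is_mchar psi -> is_mchar (mchar_pow psi k).
Proof.
move=> psiP; split; rewrite /mchar_pow ?eqxx ?oner_eq0 ?mchar1 ?expr1n //.
move=> x y; rewrite mulf_eq0; case: eqP => _; rewrite ?mul0r //=.
by case: eqP => _; rewrite ?mulr0 //= mcharM // exprMn.
Qed.

(** Sending [g] to [w] defines a character, which is a power of [chi] because [chi] generates. Hence
    [w] is a power of [chi g], and the order of [chi g] cannot be smaller than that of [w]. *)
Lemma mchar_generator_prim (F : finFieldType) (C : fieldType) (chi : F -> C)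
    (g : F) (w : C) :
  is_mchar_generator chi -> (#|F|.-1).-primitive_root g ->
  (#|F|.-1).-primitive_root w -> (#|F|.-1).-primitive_root (chi g).
Proof.
move=> [chiP chi_gen] gP wP; set N := #|F|.-1 in gP wP *.
have N0 : (0 < N)%N by exact: prim_order_gt0 gP.
have g0 := prim_root_neq0 gP.
(* The implication makes the statement true at 0 as well, so that [xchoose] yields a total discrete
   logarithm. *)
have lg (x : F) : exists i : nat, (x != 0) ==> (x == g ^+ i).
  have [->|x0] := eqVneq x 0; first by exists 0%N.
  by have [i ->] := finField_prim_rootP gP x0; exists i; rewrite eqxx.
pose l x := xchoose (lg x).
have lE x : x != 0 -> x = g ^+ l x.
  by move=> x0; move: (xchooseP (lg x)) => /implyP/(_ x0)/eqP.
(* The logarithm is determined only modulo [N]; [g] and [w] have the same order, so the power of [w]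
   does not depend on the choice. *)
have wE i j : g ^+ i = g ^+ j -> w ^+ i = w ^+ j.
  by move=> /eqP; rewrite (eq_prim_root_expr gP) -(eq_prim_root_expr wP) =>
    /eqP.
pose psi x := if x == 0 then 0 else w ^+ l x.
have psiP : is_mchar psi.
  split; rewrite /psi ?eqxx ?oner_eq0 //.
    by rewrite (wE _ 0%N) // expr0 -lE // oner_neq0.
  move=> x y; rewrite mulf_eq0; case: eqVneq => x0; rewrite ?mul0r //=.
  case: eqVneq => y0; rewrite ?mulr0 //= -exprD; apply: wE.
  by rewrite exprD -!lE ?mulf_neq0.
have [k kP] := chi_gen _ psiP.
have wk : w = chi g ^+ k.
  have := kP g; rewrite /psi /mchar_pow (negPf g0) => <-.
  by rewrite (wE _ 1%N) ?expr1 // -lE.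
have cN : chi g ^+ N = 1 by rewrite -mcharX // prim_expr_order // mchar1.
have [m mP /dvdnP[d dE]] := prim_order_exists N0 cN.
suff <- : m = N by [].
apply/eqP; rewrite eqn_dvd; apply/andP; split; first by rewrite dE dvdn_mull.
by rewrite (prim_order_dvd wP) wk exprAC (prim_expr_order mP) expr1n.
Qed.

(** * Gauss sums for a nontrivial additive character and their relation to Jacobi sums *)

Section GaussJacobi.
Variables (F : finFieldType) (C : fieldType) (e : F -> C).
Hypotheses (eD : forall x y, e (x + y) = e x * e y) (e0 : e 0 = 1).
Hypothesis e_nontrivial : exists x, e x != 1.

Let gs (A : F -> C) : C := \sum_x A x * e x.

Lemma achar_sum0 : \sum_x e x = 0.
Proof.
have [a ea1] := e_nontrivial.
have d0 : 1 - e a != 0 by rewrite subr_eq0 eq_sym.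
apply: (mulfI d0); rewrite mulr0; apply/eqP.
rewrite mulrBl mul1r subr_eq0 mulr_sumr; apply/eqP.
rewrite [LHS](reindex_inj (addrI a)) /=.
by apply: eq_bigr => x _; rewrite eD.
Qed.

Lemma achar_sum_neq0 : \sum_(x | x != 0) e x = -1.
Proof.
by have /eqP := achar_sum0; rewrite (bigD1 0) //= e0 addrC addr_eq0 => /eqP.
Qed.

Lemma gauss_trivial A : (forall x, A x = (x != 0)%:R) -> gs A = -1.
Proof.
move=> AE; rewrite -achar_sum_neq0 /gs [RHS]big_mkcond; apply: eq_bigr => x _.
by rewrite AE; case: eqP; rewrite ?mul0r ?mul1r.
Qed.

Lemma gauss_mul_conv A B :
  gs A * gs B = \sum_s e s * \sum_x A x * B (s - x).
Proof.
rewrite /gs mulr_suml.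
under [RHS]eq_bigr do rewrite mulr_sumr.
rewrite exchange_big /=; apply: eq_bigr => x _.
rewrite mulr_sumr [RHS](reindex_inj (addrI x)) /=; apply: eq_bigr => y _.
by rewrite eD [x + y - x]addrAC subrr add0r; ring.
Qed.

Section TwoChars.
Variables A B : F -> C.
Hypotheses (AP : is_mchar A) (BP : is_mchar B).

Lemma conv_jacobi s : s != 0 ->
  \sum_x A x * B (s - x) = A s * B s * jacobi A B.
Proof.
move=> s0; rewrite (reindex_inj (mulfI s0)) /jacobi mulr_sumr /=.
apply: eq_bigr => x _.
have -> : s - s * x = s * (1 - x) by ring.
by rewrite (mcharM AP) (mcharM BP); ring.
Qed.

Lemma conv0 : \sum_x A x * B (0 - x) = B (-1) * \sum_x A x * B x.
Proof.
rewrite mulr_sumr; apply: eq_bigr => x _.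
by rewrite sub0r -[- x]mulN1r (mcharM BP) mulrCA.
Qed.

(** In the convolution formula the term [s = 0] is a multiple of the sum of the nontrivial character
    [A B], hence 0. Every other term is rescaled to the Jacobi sum. *)
Lemma gauss_jacobi : (exists2 x, x != 0 & A x * B x != 1) ->
  gs A * gs B = jacobi A B * gs (fun x => A x * B x).
Proof.
move=> ABn; have ABP : is_mchar (fun x => A x * B x).
  split; rewrite ?(mchar0 AP) ?mul0r ?(mchar1 AP) ?(mchar1 BP) ?mulr1 // => x y.
  by rewrite (mcharM AP) (mcharM BP); ring.
rewrite gauss_mul_conv (bigD1 0) //= conv0 (mchar_sum0 ABP ABn) !mulr0 add0r.
rewrite /gs [in RHS](bigD1 0) //= (mchar0 AP) !mul0r add0r mulr_sumr.
by apply: eq_bigr => s s0; rewrite conv_jacobi //; ring.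
Qed.

Hypothesis ABV : forall x, A x * B x = (x != 0)%:R.
Hypothesis A_nontrivial : exists2 x, x != 0 & A x != 1.

(** Since [B] is the inverse of [A], the summand is [A (x / (1 - x))], and the quotient takes every
    value except -1. What remains is the full sum of [A], which is 0, minus [A (-1)]. *)
Lemma jacobi_inv : jacobi A B = - A (-1).
Proof.
have BE x : B x = A x^-1.
  rewrite (mcharV AP); have [->|x0] := eqVneq x 0.
    by rewrite (mchar0 AP) (mchar0 BP) invr0.
  apply: (mulfI (mchar_neq0 AP x0)).
  by rewrite ABV x0 divff // mchar_neq0.
apply/eqP; rewrite -addr_eq0 -(mchar_sum0 AP A_nontrivial) addrC; apply/eqP.
(* For [x != 1] this is [x / (1 - x)]. With [0^-1 = 0] it sends 1 to the missing value -1, so it is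
   a bijection of the whole field. *)
pose h (x : F) := (1 - x)^-1 - 1.
have h_inj : injective h by move=> x y /addIr/invr_inj/addrI/oppr_inj.
rewrite (reindex_inj h_inj) /jacobi (bigD1 1) //= [in RHS](bigD1 1) //=.
rewrite subrr (mchar0 BP) mulr0 add0r /h subrr invr0 sub0r; congr (_ + _).
apply: eq_bigr => x x1; rewrite BE -(mcharM AP); congr A.
have d : 1 - x != 0 by rewrite subr_eq0 eq_sym.
by apply: (mulIf d); rewrite mulrBl mulVf // mulfVK //; ring.
Qed.

(** The term [s = 0] of the convolution gives [A (-1)] times [#|F| - 1], and the others together
    give one more [A (-1)]. *)
Lemma gauss_inv : gs A * gs B = A (-1) * #|F|%:R.
Proof.
have BA : B (-1) = A (-1).
  have := ABV (-1); rewrite oppr_eq0 oner_eq0 /= => AB1.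
  apply: (mulfI (mchar_neq0 AP (_ : -1 != 0)));
    first by rewrite oppr_eq0 oner_eq0.
  by rewrite AB1 -expr2 mcharN1_sqr.
have rest : \sum_(s | s != 0) e s * (\sum_x A x * B (s - x)) = A (-1).
  rewrite (eq_bigr (fun s => e s * - A (-1))) => [|s s0]; last first.
    by rewrite conv_jacobi // jacobi_inv ABV s0 mul1r.
  by rewrite -mulr_suml achar_sum_neq0 mulrN mulN1r opprK.
rewrite gauss_mul_conv (bigD1 0) //= rest conv0 e0 mul1r BA.
rewrite (eq_bigr _ (fun x _ => ABV x)) -[X in _ + X]mulr1 -mulrDr.
have -> : \sum_x ((x != 0 :> F)%:R : C) = #|F|.-1%:R.
  by rewrite -natr_sum -big_mkcond sum1_card cardC1.
by rewrite natr1 prednK //; apply/card_gt0P; exists 0.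
Qed.

End TwoChars.

End GaussJacobi.

Lemma big_shift (R : Type) (idx : R) (op : Monoid.com_law idx) (h : nat -> R) m
  s :
  (forall k, h (k + m)%N = h k) ->
  \big[op/idx]_(k < m) h (k + s)%N = \big[op/idx]_(k < m) h k.
Proof.
move=> hm; elim: s => [|s IH]; first by apply: eq_bigr => k _; rewrite addn0.
case: m hm IH => [|m] hm IH; first by rewrite !big_ord0.
rewrite -IH big_ord_recr [RHS]big_ord_recl /= Monoid.mulmC; congr (op _ _).
  by rewrite add0n -(hm s); congr h; lia.
by apply: eq_bigr => k _; congr h; rewrite /= /bump /=; lia.
Qed.

Lemma prod_pair (C : comNzRingType) (h : nat -> C) v c :
  (forall k, (k < v)%N -> h k * h (2 * v - k)%N = c) ->
  \prod_(k < (2 * v).+1) h k = c ^+ v * h v.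
Proof.
elim: v h => [|v IH] h hc; first by rewrite muln0 big_ord1 expr0 mul1r.
have -> : ((2 * v.+1).+1 = (2 * v).+1.+2)%N by lia.
rewrite big_ord_recl big_ord_recr /=.
have := IH (fun k => h k.+1) => ->; last first.
  by move=> k kv; rewrite -(hc k.+1) //; congr (_ * h _); lia.
rewrite exprS -(hc 0%N) // /bump /=.
have -> : (2 * v.+1 - 0 = 1 + (2 * v).+1)%N by lia.
ring.
Qed.

(** * Powers of a generating character and products of their Gauss and Jacobi sums *)

Section CharPowers.
Variables (F : finFieldType) (C : fieldType) (chi : F -> C) (g : F).
Hypotheses (chiP : is_mchar chi) (gP : (#|F|.-1).-primitive_root g).
Hypothesis cgP : (#|F|.-1).-primitive_root (chi g).

Let N := #|F|.-1.
Let X a := mchar_pow chi a.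

Lemma mchar_inj x y : chi x = chi y -> x = y.
Proof.
have [->|x0] := eqVneq x 0.
  have [-> //|y0] := eqVneq y 0; rewrite (mchar0 chiP) => /esym/eqP.
  by rewrite (negPf (mchar_neq0 chiP y0)).
have [->|y0] := eqVneq y 0.
  by rewrite (mchar0 chiP) => /eqP; rewrite (negPf (mchar_neq0 chiP x0)).
have [i ->] := finField_prim_rootP gP x0.
have [j ->] := finField_prim_rootP gP y0.
rewrite !(mcharX chiP) => /eqP; rewrite (eq_prim_root_expr cgP).
by rewrite -(eq_prim_root_expr gP) => /eqP.
Qed.

Lemma mchar_powE a x : x != 0 -> X a x = chi x ^+ a.
Proof. by rewrite /X /mchar_pow => /negPf->. Qed.

Lemma mchar_powD a b x : X a x * X b x = X (a + b) x.
Proof. by rewrite /X /mchar_pow; case: eqP => _; rewrite ?mul0r // exprD. Qed.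

Lemma mchar_pow_triv a : (N %| a)%N -> forall x, X a x = (x != 0)%:R.
Proof.
move=> /dvdnP[d ->] x; rewrite /X /mchar_pow; case: eqVneq => x0 //=.
have [i ->] := finField_prim_rootP gP x0.
apply/eqP; rewrite (mcharX chiP) -exprM -(prim_order_dvd cgP).
by rewrite !dvdn_mull.
Qed.

Lemma mchar_pow_nontriv a : ~~ (N %| a)%N -> exists2 x, x != 0 & X a x != 1.
Proof.
move=> Na; exists g; first exact: prim_root_neq0 gP.
by rewrite mchar_powE ?(prim_root_neq0 gP) // -(prim_order_dvd cgP).
Qed.

Lemma mchar_pow_mod a b : a = b %[mod N] -> X a =1 X b.
Proof.
move=> ab x; rewrite /X /mchar_pow; case: eqVneq => x0 //=.
have [i ->] := finField_prim_rootP gP x0; rewrite (mcharX chiP) !(exprAC _ i).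
by congr (_ ^+ i); apply/eqP; rewrite (eq_prim_root_expr cgP); apply/eqP.
Qed.

Lemma mcharN1 : (2%:R : F) != 0 -> chi (-1) = -1.
Proof.
move=> two0; have /eqP := mcharN1_sqr chiP; rewrite sqrf_eq1.
case/orP => /eqP // c1; have : -1 = 1 :> F by apply: mchar_inj;
  rewrite c1 mchar1.
by move/eqP; rewrite eq_sym -addr_eq0 -mulr2n (negPf two0).
Qed.

Variable e : F -> C.
Hypotheses (eD : forall x y, e (x + y) = e x * e y) (e0 : e 0 = 1).
Hypothesis e_nontrivial : exists x, e x != 1.
Hypothesis card_neq0 : #|F|%:R != 0 :> C.
Hypothesis two_neq0 : (2%:R : F) != 0.

Let G a : C := \sum_x X a x * e x.
Let J a b := jacobi (X a) (X b).

Lemma gauss_pow0 a : (N %| a)%N -> G a = -1.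
Proof. by move=> /mchar_pow_triv; exact: gauss_trivial. Qed.

Lemma gauss_pow_mod a b : a = b %[mod N] -> G a = G b.
Proof. by move=> ab; apply: eq_bigr => x _; rewrite (mchar_pow_mod ab). Qed.

Lemma mchar_powN1 a : X a (-1) = (-1) ^+ a.
Proof. by rewrite mchar_powE ?oppr_eq0 ?oner_eq0 // mcharN1. Qed.

Lemma gauss_pow_jacobi a b : ~~ (N %| a + b)%N -> G a * G b = J a b * G (a + b).
Proof.
move=> /mchar_pow_nontriv[x x0 xn]; rewrite /G gauss_jacobi //; last first.
- by exists x; rewrite ?mchar_powD.
- exact: mchar_powP.
- exact: mchar_powP.
by congr (_ * _); apply: eq_bigr => y _; rewrite mchar_powD.
Qed.

Lemma gauss_pow_inv a b : (N %| a + b)%N -> ~~ (N %| a)%N ->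
  G a * G b = (-1) ^+ a * #|F|%:R /\ J a b = - (-1) ^+ a.
Proof.
move=> Nab /mchar_pow_nontriv Xa; have Xab x : X a x * X b x = (x != 0)%:R.
  by rewrite mchar_powD mchar_pow_triv.
have XP k : is_mchar (X k) by exact: mchar_powP.
by split; rewrite ?/G ?/J ?gauss_inv ?jacobi_inv // mchar_powN1.
Qed.

Lemma gauss_pow_neq0 a : G a != 0.
Proof.
have [Na|Na] := boolP (N %| a)%N;
  first by rewrite gauss_pow0 // oppr_eq0 oner_eq0.
have N0 : (0 < N)%N := prim_order_gt0 gP.
(* [N * a - a] is a natural number representing the exponent [- a] modulo [N]. *)
have [] := @gauss_pow_inv a (N * a - a) _ Na.
  by rewrite subnKC ?leq_pmull // dvdn_mulr.
move=> Gab _; have : G a * G (N * a - a) != 0.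
  by rewrite Gab mulf_neq0 // expf_neq0 // oppr_eq0 oner_eq0.
by apply: contraNneq => ->; rewrite mul0r.
Qed.

Variable v : nat.
Hypothesis NE : N = (2 * (2 * v).+1)%N.

(** The exponents run over all even residues modulo [N]. Opposite nonzero ones contribute [#|F|] per
    pair, and the trivial character contributes -1. *)
Lemma gauss_pow_prod_even s :
  \prod_(k < (2 * v).+1) G (2 * s + 2 * k) = - #|F|%:R ^+ v.
Proof.
pose h k := G (2 * k).
have hm k : h (k + (2 * v).+1)%N = h k.
  by apply: gauss_pow_mod; rewrite NE mulnDr modnDr.
have -> : \prod_(k < (2 * v).+1) G (2 * s + 2 * k) = \prod_(k < (2 * v).+1) h k.
  rewrite -(big_shift _ s hm); apply: eq_bigr => k _; congr G; lia.
(* The shift puts the trivial exponent [N] at the middle index [v], the one left unpaired. *)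
rewrite -(big_shift _ v.+1 hm).
rewrite (@prod_pair _ (fun k => h (k + v.+1)%N) v #|F|%:R) /h.
  rewrite [G _]gauss_pow0 ?mulrN1 // NE; apply/dvdnP; exists 1%N; lia.
move=> k kv; have [] := @gauss_pow_inv (2 * (k + v.+1)) (2 * (2 * v - k +
  v.+1)).
- by rewrite NE; apply/dvdnP; exists 2; lia.
- by rewrite NE gtnNdvd //; lia.
by move=> -> _; rewrite exprM sqrrN !expr1n mul1r.
Qed.

(** Opposite odd exponents contribute [- #|F|] per pair. The unpaired exponent [2 v + 1 = N / 2]
    belongs to the quadratic character. *)
Lemma gauss_pow_prod_odd s :
  \prod_(k < (2 * v).+1) G ((2 * s).+1 + 2 * k) =
    (- #|F|%:R) ^+ v * G (2 * v).+1.
Proof.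
pose h k := G (2 * k).+1.
have hm k : h (k + (2 * v).+1)%N = h k.
  by apply: gauss_pow_mod; rewrite NE mulnDr -addSn modnDr.
have -> : \prod_(k < (2 * v).+1) G ((2 * s).+1 + 2 * k) =
          \prod_(k < (2 * v).+1) h k.
  rewrite -(big_shift _ s hm); apply: eq_bigr => k _; congr G; lia.
apply: prod_pair => k kv.
have [] := @gauss_pow_inv (2 * k).+1 (2 * (2 * v - k)).+1.
- by rewrite NE; apply/dvdnP; exists 1%N; lia.
- by rewrite NE gtnNdvd //; lia.
by move=> -> _; rewrite exprS exprM sqrrN !expr1n mulr1 mulN1r.
Qed.

(** The relation [G r * G (2 k) = J r (2 k) * G (r + 2 k)] is multiplied over all [k]. As [r + 2 k]
    is odd and [N] even, the product character is never trivial. *)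
Lemma jacobi_prod_odd r : odd r ->
  \prod_(k < (2 * v).+1) J r (2 * k) =
    - (-1) ^+ v * G r ^+ (2 * v).+1 / G (2 * v).+1.
Proof.
move=> r_odd; have rE : r = (2 * r./2).+1 by rewrite -[LHS]odd_double_half
  r_odd; lia.
have q0 : (- #|F|%:R : C) ^+ v != 0 by rewrite expf_neq0 // oppr_eq0.
have GJ k : G r * G (2 * k) = J r (2 * k) * G (r + 2 * k).
  apply: gauss_pow_jacobi; apply: contraL (r_odd) => Nd.
  have : (2 %| r + 2 * k)%N by apply: dvdn_trans Nd; rewrite NE dvdn_mulr.
  by rewrite dvdn_addl ?dvdn_mulr // dvdn2.
have : \prod_(k < (2 * v).+1) (G r * G (2 * k)) =
       \prod_(k < (2 * v).+1) (J r (2 * k) * G (r + 2 * k)).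
  by apply: eq_bigr => k _; exact: GJ.
rewrite !big_split /= prodr_const card_ord.
have := gauss_pow_prod_odd r./2; rewrite -rE => ->.
have := gauss_pow_prod_even 0; rewrite muln0 => ->.
move=> EP; apply: (mulIf (gauss_pow_neq0 (2 * v).+1)).
rewrite mulfVK ?gauss_pow_neq0 //; apply: (mulfI q0).
rewrite mulrCA -EP [(- #|F|%:R) ^+ v]exprNn.
have zz : (-1) ^+ v * (-1) ^+ v = 1 :> C by rewrite -expr2 exprAC sqrrN !expr1n.
move: ((-1) ^+ v) zz (_ ^+ v) (_ ^+ (_.+1)) => z zz a b.
transitivity (- (z * z) * a * b); first by rewrite zz; ring.
by ring.
Qed.

(** Now [r + 2 k] is divisible by [N] for exactly one index [k0]. There the Gauss-Jacobi relation
    holds only after an extra factor [#|F|], which becomes the denominator. *)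
Lemma jacobi_prod_even r : (0 < r < N)%N -> ~~ odd r ->
  \prod_(k < (2 * v).+1) J r (2 * k) = G r ^+ (2 * v).+1 / #|F|%:R.
Proof.
move=> /andP[r0 rN] r_even.
have rE : r = (2 * r./2)%N by rewrite -[LHS]odd_double_half (negPf r_even); lia.
have q0 : - (#|F|%:R : C) ^+ v != 0 by rewrite oppr_eq0 expf_neq0.
(* [k0] solves [r + 2 k0 = N]; it lies in range because [r] is even and positive. *)
have k0P : ((2 * v).+1 - r./2 < (2 * v).+1)%N by lia.
pose k0 := Ordinal k0P.
have NrN : ~~ (N %| r)%N by rewrite gtnNdvd.
have GJ (k : 'I_(2 * v).+1) : k != k0 ->
    G r * G (2 * k) = J r (2 * k) * G (r + 2 * k).
  move=> kk0; apply: gauss_pow_jacobi; apply: contra kk0 => /dvdnP[d dE].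
  have kv := ltn_ord k; apply/eqP/val_inj => /=.
  have d1 : (d = 1)%N by nia.
  by move: dE; rewrite d1; lia.
have GJ0 : G r * G (2 * k0) = #|F|%:R * (J r (2 * k0) * G (r + 2 * k0)).
  have Nk0 : (N %| r + 2 * k0)%N by apply/dvdnP; exists 1%N; rewrite /=; lia.
  have [-> ->] := gauss_pow_inv Nk0 NrN.
  by rewrite gauss_pow0 // -signr_odd (negPf r_even) expr0; ring.
have : \prod_(k < (2 * v).+1) (G r * G (2 * k)) =
       #|F|%:R * \prod_(k < (2 * v).+1) (J r (2 * k) * G (r + 2 * k)).
  rewrite (bigD1 k0) //= GJ0 [in RHS](bigD1 k0) //= -!mulrA.
  by congr (_ * (_ * (_ * _))); apply: eq_bigr => k; exact: GJ.
rewrite !big_split /= prodr_const card_ord.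
have := gauss_pow_prod_even r./2; rewrite -rE => ->.
have := gauss_pow_prod_even 0; rewrite muln0 => ->.
rewrite mulrA => /(mulIf q0) ->.
by rewrite mulrAC divff // mul1r.
Qed.

End CharPowers.

(** * The determinants *)

Section PowerSubgroups.
Variables (F : finFieldType) (g : F).
Hypothesis gP : (#|F|.-1).-primitive_root g.

(** In a cyclic group of order [N], the [k]-th powers form the kernel of raising to the power
    [N / k]. *)
Lemma mem_Dset k t : (k %| #|F|.-1)%N ->
  (t \in Dset F k) = (t ^+ (#|F|.-1 %/ k) == 1).
Proof.
set N := #|F|.-1; move=> kN; have N0 : (0 < N)%N := prim_order_gt0 gP.
have k0 : (0 < k)%N := dvdn_gt0 N0 kN.
have M0 : (0 < N %/ k)%N by rewrite divn_gt0 // dvdn_leq.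
apply/imsetP/eqP => [[y] | tM].
  rewrite inE => y0 ->; have [i ->] := finField_prim_rootP gP y0.
  apply/eqP; rewrite -!exprM -(prim_order_dvd gP).
  by rewrite [(k * _)%N]mulnC divnK // dvdn_mull.
have t0 : t != 0.
  by apply/eqP => t0; move/eqP: tM;
    rewrite t0 expr0n gtn_eqF // eq_sym oner_eq0.
have [i ti] := finField_prim_rootP gP t0.
have ki : (k %| i)%N.
  move/eqP: tM; rewrite ti -exprM -(prim_order_dvd gP) -/N -{1}(divnK kN).
  by rewrite mulnC dvdn_pmul2r.
exists (g ^+ (i %/ k)); first by rewrite inE expf_neq0 // (prim_root_neq0 gP).
by rewrite -exprM divnK.
Qed.

Lemma expf_card_pred (x : F) : x != 0 -> x ^+ #|F|.-1 = 1.
Proof.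
move=> x0; have [i ->] := finField_prim_rootP gP x0.
by rewrite exprAC (prim_expr_order gP) expr1n.
Qed.

End PowerSubgroups.

Lemma sqr_odd_eq1 (R : comNzRingType) (x : R) m :
  odd m -> x ^+ 2 = 1 -> x ^+ m = 1 -> x = 1.
Proof.
move=> m_odd x2; rewrite -[m]odd_double_half m_odd exprD -mul2n exprM x2 expr1n.
by rewrite mulr1 expr1.
Qed.

Section DetB.
Variables (F : finFieldType) (C : fieldType) (chi psi : F -> C) (g : F).
Hypotheses (chiP : is_mchar chi) (gP : (#|F|.-1).-primitive_root g).
Hypotheses (cgP : (#|F|.-1).-primitive_root (chi g)) (psiP : is_mchar psi).
Hypothesis two_neq0 : (2%:R : F) != 0.
Variable m : nat.

(** An even [(q - 1) / k] puts both 1 and -1 in [D_k]. An entry does not change when [a j] becomes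
    [- a j], so the columns of 1 and -1 agree. *)
Lemma det_Bmat_eq0 k (a : 'I_m -> F) : (k %| #|F|.-1)%N ->
  ~~ odd (#|F|.-1 %/ k) -> [set a i | i : 'I_m] = Dset F k ->
  \det (Bmat psi a) = 0.
Proof.
move=> kN ev aD.
have DE t := mem_Dset gP t kN.
have : 1 \in Dset F k by rewrite DE expr1n.
rewrite -aD => /imsetP[i _ ai].
have : -1 \in Dset F k by rewrite DE -signr_odd (negPf ev).
rewrite -aD => /imsetP[j _ aj].
have ij : i != j.
  apply/eqP => ij; have : 1 = -1 :> F by rewrite aj -ij -ai.
  by move/eqP; rewrite -addr_eq0 -mulr2n (negPf two_neq0).
rewrite -det_tr; apply: (determinant_alternate ij) => l; rewrite !mxE.
by rewrite -ai -aj opprK addrC.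
Qed.

Hypotheses (m_odd : odd m) (mE : #|F|.-1 = (2 * m)%N).
Variable a : 'I_m -> F.
Hypotheses (a_inj : injective a) (aD : [set a i | i : 'I_m] = Dset F 2).

Let DE t : (t \in Dset F 2) = (t ^+ m == 1).
Proof. by rewrite (mem_Dset gP) mE ?dvdn_mulr // mulKn. Qed.

Let D0 : (0 \in Dset F 2) = false.
Proof. by rewrite DE expr0n; case: (m) m_odd => //= ? _;
  rewrite eq_sym oner_eq0. Qed.

Let am i : a i ^+ m = 1.
Proof. by apply/eqP; rewrite -DE -aD; apply: imset_f. Qed.

Let a_neq0 i : a i != 0.
Proof.
by apply/eqP => ai; have := DE (a i); rewrite am eqxx ai D0.
Qed.

Lemma sum_squares (h : F -> C) : \sum_i h (a i) = \sum_(t in Dset F 2) h t.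
Proof. by rewrite -aD big_imset //= => i j _ _ /a_inj. Qed.

(** Inversion permutes the squares, so the product has square 1; its [m]-th power is also 1, with
    [m] odd. *)
Lemma prod_squares : \prod_i a i = 1.
Proof.
have prodD (h : F -> F) : \prod_i h (a i) = \prod_(t in Dset F 2) h t.
  by rewrite -aD big_imset //= => i j _ _ /a_inj.
apply: (sqr_odd_eq1 m_odd); last first.
  by rewrite -prodrXl big1 // => i _; exact: am.
have inv : \prod_i a i = \prod_i (a i)^-1.
  rewrite (prodD id) (prodD (fun t => t^-1)) (reindex_inj invr_inj) /=.
  by apply: eq_bigl => t; rewrite !DE exprVn invr_eq1.
rewrite expr2 {2}inv -big_split big1 //= => i _.
by rewrite divff.
Qed.

Lemma sum_squares_mulr (h : F -> C) i :
  \sum_(t in Dset F 2) h (t / a i) = \sum_(t in Dset F 2) h t.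
Proof.
rewrite (reindex_inj (mulIf (a_neq0 i))) /=.
by apply: eq_big => [t|t _]; rewrite ?mulfK // !DE exprMn am mulr1.
Qed.

(** As [m] is odd, -1 is not a square, and the units are the squares and their negatives. The
    character [chi^(2k)] is even, so the nonsquare [- t] supplies the term [psi (1 + t)]. *)
Lemma jacobi_split k :
  \sum_(t in Dset F 2) (psi (1 + t) + psi (1 - t)) * chi t ^+ (2 * k)
  = jacobi psi (mchar_pow chi (2 * k)).
Proof.
have -> : jacobi psi (mchar_pow chi (2 * k)) =
          \sum_t psi (1 - t) * mchar_pow chi (2 * k) t.
  rewrite /jacobi (reindex_inj (subrI 1)) /=; apply: eq_bigr => t _.
  by congr (_ * mchar_pow _ _ _); rewrite opprB addrC subrK.
rewrite [RHS](bigD1 0) //= [X in _ * X + _]/mchar_pow eqxx mulr0 add0r.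
rewrite [RHS](bigID [in Dset F 2]) /=.
under eq_bigr do rewrite mulrDl.
rewrite big_split /= addrC; congr (_ + _).
  apply: eq_big => [t|t tD].
    by have [->|] := eqVneq t 0; rewrite ?D0.
  by congr (_ * _); rewrite /mchar_pow; case: eqP tD => // ->; rewrite D0.
rewrite [LHS](reindex_inj oppr_inj) /=; apply: eq_big => [t|t tD].
  have [->|t0] := eqVneq t 0; first by rewrite oppr0 D0.
  rewrite !DE exprNn -signr_odd m_odd mulN1r.
  have /eqP : (t ^+ m) ^+ 2 = 1 by rewrite -exprM mulnC -mE (expf_card_pred gP).
  rewrite sqrf_eq1 => /orP[] /eqP ->; rewrite ?opprK ?eqxx /=.
    by rewrite eq_sym -addr_eq0 -mulr2n (negPf two_neq0).
  by rewrite eq_sym -addr_eq0 -mulr2n two_neq0.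
have t0 : t != 0.
  by apply: contraTneq tD => ->; rewrite oppr0 D0.
congr (_ * _); rewrite (mchar_powE _ _ t0) !exprM -!(mcharX chiP).
by rewrite sqrrN.
Qed.

Lemma det_Bmat_squares :
  \det (Bmat psi a) = \prod_(k < m) jacobi psi (mchar_pow chi (2 * k)).
Proof.
(* The columns of [V] are the characters [chi^(2k)] of the group of squares. *)
pose V : 'M[C]_m := \matrix_(j, k) chi (a j) ^+ (2 * k).
pose J : 'rV[C]_m := \row_k jacobi psi (mchar_pow chi (2 * k)).
pose P : 'rV[C]_m := \row_i psi (a i).
have VE : Bmat psi a *m V = diag_mx P *m V *m diag_mx J.
  apply/matrixP => i k; rewrite mul_mx_diag mul_diag_mx !mxE.
  (* Substituting [t = a j / a i] takes [psi (a i)] and [chi (a i) ^+ (2 * k)] out of row [i],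
     leaving a sum independent of [i]. *)
  rewrite -jacobi_split -(sum_squares_mulr _ i) -sum_squares mulr_sumr.
  apply: eq_bigr => j _; rewrite !mxE.
  have -> : a i + a j = a i * (1 + a j / a i) by rewrite mulrDr mulr1 mulrC
    mulfVK.
  have -> : a i - a j = a i * (1 - a j / a i) by rewrite mulrBr mulr1 mulrC
    mulfVK.
  rewrite !(mcharM psiP) (mcharM chiP) exprMn (mcharV chiP) exprVn.
  have c0 : chi (a i) ^+ (2 * k) != 0 by rewrite expf_neq0 // mchar_neq0.
  move: (chi (a i) ^+ _) (chi (a j) ^+ _) (psi (1 + _)) (psi (1 - _)) c0.
  by move=> c d x y c0; field.
(* The transpose is a Vandermonde matrix in the [chi (a j) ^+ 2]; these are distinct because
   squaring is injective on a group of odd order. *)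
have V0 : \det V != 0.
  rewrite -det_tr.
  have -> : V^T = Vandermonde m (\row_j chi (a j) ^+ 2).
    by apply/matrixP => i j; rewrite !mxE exprM.
  rewrite det_Vandermonde; apply/prodf_neq0 => i _; apply/prodf_neq0 => j ij.
  rewrite !mxE subr_eq0 -!(mcharX chiP);
    apply/eqP => /(mchar_inj chiP gP cgP) aij.
  have : a j / a i = 1.
    apply: (sqr_odd_eq1 m_odd); rewrite expr_div_n ?am ?divr1 // aij.
    by rewrite divff // expf_neq0.
  move/(canRL (mulfVK (a_neq0 i))); rewrite mul1r => /a_inj ji.
  by move: ij; rewrite ji ltnn.
have P1 : \det (diag_mx P) = 1.
  rewrite det_diag; transitivity (psi (\prod_i a i)); last first.
    by rewrite prod_squares (mchar1 psiP).
  rewrite (big_morph psi (mcharM psiP) (mchar1 psiP)).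
  by apply: eq_bigr => i _; rewrite mxE.
have := congr1 determinant VE;
  rewrite !det_mulmx P1 mul1r mulrC => /(mulfI V0) ->.
by rewrite det_diag; apply: eq_bigr => k _; rewrite mxE.
Qed.

End DetB.

(** * The trace form and an isotropic subspace *)

(** The left side is the leading coefficient of the Lagrange interpolant of ['X^k] at [n + 1]
    points, and for [k <= n] this interpolant is ['X^k] itself. *)
Lemma lagrange_sum (F : fieldType) n (x : 'I_n.+1 -> F) k :
  injective x -> (k <= n)%N ->
  \sum_i x i ^+ k / (\prod_(l | l != i) (x i - x l)) = (k == n)%:R.
Proof.
move=> x_inj kn.
pose D i := \prod_(l | l != i) (x i - x l).
have D0 i : D i != 0.
  apply/prodf_neq0 => l li; rewrite subr_eq0; apply: contra li => /eqP/x_inj->.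
  by [].
pose Q i : {poly F} := \prod_(l <- enum (predC1 i)) ('X - (x l)%:P).
have Qx i : (Q i).[x i] = D i.
  rewrite horner_prod big_enum; apply: eq_bigr => l _; exact: hornerXsubC.
have Qx0 i j : j != i -> (Q i).[x j] = 0.
  move=> ji; rewrite horner_prod big_enum /= (bigD1 j) //= hornerXsubC subrr.
  by rewrite mul0r.
have szQ i : size (Q i) = n.+1.
  by rewrite size_prod_XsubC -cardE cardC1 card_ord.
have cQ i : (Q i)`_n = 1.
  have /monicP := monic_prod_XsubC (enum (predC1 i)) xpredT x.
  by rewrite lead_coefE -/(Q i) szQ.
pose L := \sum_i (x i ^+ k / D i) *: Q i - 'X^k.
have L0 : L = 0.
  apply: (@roots_geq_poly_eq0 _ _ [seq x i | i <- enum 'I_n.+1]).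
  - apply/allP => _ /mapP[j _ ->]; apply/rootP.
    rewrite hornerD hornerN hornerXn horner_sum (bigD1 j) //= big1 ?addr0.
      by rewrite hornerZ Qx mulfVK ?D0 // subrr.
    by move=> i ij; rewrite hornerZ Qx0 ?mulr0 // eq_sym.
  - by rewrite map_inj_uniq ?enum_uniq.
  rewrite size_map size_enum_ord (leq_trans (size_polyD _ _)) // geq_max.
  rewrite size_polyN size_polyXn ltnS kn andbT.
  apply: (leq_trans (size_sum _ _ _)); apply/bigmax_leqP => i _.
  by rewrite (leq_trans (size_scale_leq _ _)) // szQ.
have /(congr1 (fun P : {poly F} => P`_n)) := L0.
rewrite coefB coefXn coef_sum coef0 => /eqP; rewrite subr_eq0 => /eqP Ek.
rewrite [k == n]eq_sym -Ek; apply: eq_bigr => i _.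
by rewrite coefZ cQ mulr1.
Qed.

Section Trace.
Variables (F : finFieldType) (p n : nat).
Hypotheses (p_pr : prime p) (cardF : #|F| = (p ^ n)%N).

Lemma char_of_card : p \in [pchar F].
Proof. exact: card_finPcharP cardF p_pr. Qed.

Lemma natr2_neq0 : odd p -> (2%:R : F) != 0.
Proof.
move=> p_odd; rewrite -(dvdn_pcharf char_of_card) gtnNdvd //.
by have := prime_gt1 p_pr; lia.
Qed.

Let frob : {rmorphism F -> F} := pFrobenius_aut char_of_card.
Let T := @ftrace F p n.

Lemma iter_frobD x y j : (x + y : F) ^+ (p ^ j) = x ^+ (p ^ j) + y ^+ (p ^ j).
Proof. by rewrite exprDn_pchar // pnatX pnatE // char_of_card. Qed.

Lemma expf_pX (x : F) j : x ^+ (p ^ (j + n)) = x ^+ (p ^ j).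
Proof. by rewrite addnC expnD exprM -cardF expf_card. Qed.

Lemma expf_p_modn (x : F) j : x ^+ (p ^ (j %% n)) = x ^+ (p ^ j).
Proof.
rewrite [in RHS](divn_eq j n); elim: (j %/ n)%N => [|d IH];
  first by rewrite add0n.
by rewrite mulSn -addnA addnC expf_pX.
Qed.

Lemma ftraceD x y : T (x + y) = T x + T y.
Proof. by rewrite /T /ftrace -big_split; apply: eq_bigr => j _;
  exact: iter_frobD. Qed.

Lemma natr_p_inj i j : (i < p)%N -> (j < p)%N -> i%:R = j%:R :> F -> i = j.
Proof.
wlog ij : i j / (i <= j)%N => [th|ip jp /eqP].
  by case: (leqP i j) => [|/ltnW] ij ip jp E; [exact: th|symmetry; exact: th].
rewrite eq_sym -subr_eq0 -natrB // -(dvdn_pcharf char_of_card) => /dvdnP[d dE].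
by case: d dE => [|d] dE; lia.
Qed.

Lemma natr_fixed m : (m%:R : F) ^+ p = m%:R.
Proof. exact: (rmorph_nat frob). Qed.

(** The [p] natural numbers below [p] are already roots of ['X^p - 'X]; one more fixed point would
    exceed its degree. *)
Lemma fixed_natr (c : F) : c ^+ p = c -> exists m : 'I_p, m%:R = c.
Proof.
move=> cp; have p1 := prime_gt1 p_pr.
have [/codomP[m ->]|cN] := boolP (c \in codom (fun m : 'I_p => m%:R : F)).
  by exists m.
pose P : {poly F} := 'X^p - 'X.
have szP : size P = p.+1.
  by rewrite /P size_polyDl size_polyXn // size_polyN size_polyX.
have P0 : P != 0 by rewrite -size_poly_eq0 szP.
have rootPx x : x ^+ p = x -> root P x.
  by move=> xp; rewrite /root hornerD hornerN hornerXn hornerX xp subrr.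
suff : (size (c :: codom (fun m : 'I_p => m%:R : F)) < size P)%N.
  by rewrite /= size_codom card_ord szP ltnn.
apply: max_poly_roots => //.
  by rewrite /= rootPx //; apply/allP => _ /codomP[m ->];
    apply/rootPx/natr_fixed.
rewrite /= cN map_inj_uniq ?enum_uniq // => i j ij.
exact/val_inj/(natr_p_inj (ltn_ord i) (ltn_ord j) ij).
Qed.

Lemma ftraceZ c x : c ^+ p = c -> T (c * x) = c * T x.
Proof.
move=> cp; rewrite /T /ftrace mulr_sumr; apply: eq_bigr => j _.
rewrite exprMn; congr (_ * _).
by elim: (val j) => [|i IH]; rewrite ?expn0 ?expr1 // expnS exprM cp.
Qed.

Hypothesis n_gt0 : (0 < n)%N.

Lemma ftrace_fixed x : T x ^+ p = T x.
Proof.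
rewrite -[T x ^+ p]/(frob (T x)) /T /ftrace (rmorph_sum frob) /=.
case: (n) n_gt0 (expf_pX x 0) => // n' _ xn.
rewrite big_ord_recr [RHS]big_ord_recl /= addrC; congr (_ + _).
  by rewrite pFrobenius_autE -exprM -expnSr -xn.
by apply: eq_bigr => j _; rewrite pFrobenius_autE -exprM -expnSr.
Qed.

Variable th : F.
Hypothesis thP : (#|F|.-1).-primitive_root th.

Lemma conj_inj i j : (i < n)%N -> (j < n)%N ->
  th ^+ (p ^ i) = th ^+ (p ^ j) -> i = j.
Proof.
move=> iN jN /eqP; rewrite (eq_prim_root_expr thP) cardF.
have p1 := prime_gt1 p_pr.
have bound k : (k < n)%N -> (0 < p ^ k)%N /\ (p * p ^ k <= p ^ n)%N.
  by move=> kn; rewrite expn_gt0 ltnW //= -expnS leq_exp2l.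
have [[pi0 pi] [pj0 pj]] := (bound i iN, bound j jN).
(* If [p ^ n = 2], congruence modulo the order 1 says nothing, but both exponents are 1. If
   [p ^ n > 2], both are below [p ^ n - 1] and reduction changes nothing. *)
case: (ltngtP (p ^ n)%N 2) => pn; [nia| |move=> _; apply: (expnI p1); nia].
by rewrite !modn_small; [move=> /eqP/(expnI p1)|nia|nia].
Qed.

(** For a generator [th] of the field, this is the derivative of its minimal polynomial over the
    prime field, evaluated at [th]. *)
Definition conj_diff := \prod_(j < n.-1) (th - th ^+ (p ^ j.+1)).

Lemma conj_diff_neq0 : conj_diff != 0.
Proof.
apply/prodf_neq0 => j _; rewrite subr_eq0 -{1}[th]expr1 -[in X in X == _](expn0
  p).
apply/eqP => /conj_inj; have := ltn_ord j; move=> jn.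
by move=> /(_ n_gt0) E; have /E : (j.+1 < n)%N by lia.
Qed.

(** Euler's formula: the conjugates of [th ^+ k / conj_diff] are the terms of the Lagrange sum at
    the conjugates of [th]. *)
Lemma ftrace_euler k : (k < n)%N -> T (th ^+ k / conj_diff) = (k == n.-1)%:R.
Proof.
move=> kn; pose x (i : 'I_n.-1.+1) := th ^+ (p ^ i).
have nE : n.-1.+1 = n by rewrite prednK.
have x_inj : injective x.
  by move=> i j /conj_inj E; apply/val_inj/E;
    rewrite -[X in (_ < X)%N]nE ltn_ord.
have kn1 : (k <= n.-1)%N by lia.
rewrite -(lagrange_sum x_inj kn1) /T /ftrace -(big_mkord xpredT (fun j => _ ^+
  (p ^ j))).
rewrite -{1}nE big_mkord; apply: eq_bigr => i _.
rewrite expr_div_n exprAC; congr (_ / _).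
(* Ordinals below [n] add modulo [n], so adding [i] matches the action of the [i]-th Frobenius on
   the conjugates. *)
rewrite /conj_diff -prodrXl (reindex_inj (addrI i)) /=.
rewrite [RHS](eq_bigl (fun l => l != 0)); last first.
  by move=> l; rewrite -[X in _ != X]addr0 (inj_eq (addrI i)).
rewrite [RHS]big_mkcond big_ord_recl /= ?eqxx mul1r; apply: eq_bigr => j _.
rewrite /= /x.
have -> : (th - th ^+ (p ^ j.+1)) ^+ (p ^ i) =
          th ^+ (p ^ i) - th ^+ (p ^ (i + j.+1)).
  apply: (addIr ((th ^+ (p ^ j.+1)) ^+ (p ^ i))).
  by rewrite -iter_frobD subrK -exprM -expnD addnC subrK.
congr (_ - _); rewrite /= /bump leq0n add1n -[LHS]expf_p_modn.
by congr (_ ^+ (p ^ (_ %% _))); rewrite nE.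
Qed.

End Trace.

(** * Reduction of the quadratic exponential sum to the prime field through an isotropic subspace *)

Section IsotropicSubspace.
Variables (F : finFieldType) (p h : nat).
Hypothesis p_pr : prime p.
Let n := (2 * h).+1.
Hypothesis cardF : #|F| = (p ^ n)%N.
Variable th : F.
Hypothesis thP : (#|F|.-1).-primitive_root th.
Variables (C : numFieldType) (zeta : C) (e : F -> C).
Hypothesis zetaP : p.-primitive_root zeta.
Hypothesis eE : forall x m, m%:R = ftrace p n x -> e x = zeta ^+ m.

Let n_gt0 : (0 < n)%N. Proof. by []. Qed.
Let charF := char_of_card p_pr cardF.
Let frob : {rmorphism F -> F} := pFrobenius_aut charF.
Let T := @ftrace F p n.
Let y := conj_diff p n th.

Let TD x1 x2 : T (x1 + x2) = T x1 + T x2.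
Proof. exact: ftraceD. Qed.

Let TZ c x : c ^+ p = c -> T (c * x) = c * T x.
Proof. exact: ftraceZ. Qed.

Let T_euler k : (k < n)%N -> T (th ^+ k / y) = (k == (2 * h)%N)%:R.
Proof. exact: (ftrace_euler p_pr cardF n_gt0 thP). Qed.

Lemma achar_exp x : exists2 m : 'I_p, m%:R = T x & e x = zeta ^+ m.
Proof.
have [m mE] := fixed_natr p_pr cardF (ftrace_fixed p_pr cardF n_gt0 x).
by exists m => //; exact: eE.
Qed.

Lemma acharD x1 x2 : e (x1 + x2) = e x1 * e x2.
Proof.
have [m1 m1E ->] := achar_exp x1; have [m2 m2E ->] := achar_exp x2.
by rewrite -exprD; apply: eE; rewrite natrD m1E m2E -TD.
Qed.

Lemma achar_eq1 x : (e x == 1) = (T x == 0).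
Proof.
have [m mE ->] := achar_exp x.
by rewrite -(prim_order_dvd zetaP) (dvdn_pcharf charF) mE.
Qed.

(** Having coefficients in the prime field, stated as invariance under Frobenius so that closure
    under the ring operations is immediate. *)
Let fixed (P : {poly F}) := map_poly frob P = P.

Lemma fixed_coef P i : fixed P -> P`_i ^+ p = P`_i.
Proof. by move=> /(congr1 (fun Q : {poly F} => Q`_i)); rewrite coef_map. Qed.

Lemma fixedD P Q : fixed P -> fixed Q -> fixed (P + Q).
Proof. by rewrite /fixed rmorphD /= => -> ->. Qed.

Lemma fixedN P : fixed P -> fixed (- P).
Proof. by rewrite /fixed rmorphN /= => ->. Qed.

Lemma fixedM P Q : fixed P -> fixed Q -> fixed (P * Q).
Proof. by rewrite /fixed rmorphM /= => -> ->. Qed.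

Lemma fixedXn k : fixed 'X^k.
Proof. by rewrite /fixed map_polyXn. Qed.

Lemma fixedC c : c ^+ p = c -> fixed c%:P.
Proof. by move=> cp; rewrite /fixed map_polyC /= pFrobenius_autE cp. Qed.

Lemma ftrace_horner P : fixed P -> (size P <= n)%N -> T (P.[th] / y) = P`_(2 *
  h).
Proof.
move=> PK szP; rewrite (horner_coef_wide _ szP) mulr_suml.
rewrite (big_morph T TD (_ : T 0 = 0)); last first.
  by apply/(addIr (T 0)); rewrite add0r -TD addr0.
rewrite (bigD1 ord_max) //= big1 => [|i iN].
  rewrite addr0 -mulrA (TZ _ (fixed_coef _ PK)).
  by rewrite T_euler // eqxx mulr1.
rewrite -mulrA (TZ _ (fixed_coef _ PK)).
rewrite T_euler //.
have /negPf-> : nat_of_ord i != (2 * h)%N by apply: contra iN => /eqP iE;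
  apply/eqP/val_inj.
by rewrite mulr0.
Qed.

Lemma horner_conj0 P j : fixed P -> P.[th] = 0 -> P.[th ^+ (p ^ j)] = 0.
Proof.
move=> PK P0; elim: j => [|j IH]; first by rewrite expn0 expr1.
have -> : th ^+ (p ^ j.+1) = frob (th ^+ (p ^ j)).
  by rewrite /= pFrobenius_autE -exprM -expnSr.
by rewrite -PK horner_map IH rmorph0.
Qed.

(** There are [p ^ n] polynomials of size at most [n] over the prime field. Evaluation at [th] is
    injective on them, because a difference vanishing at [th] vanishes at all [n] conjugates;
    counting gives surjectivity. *)
Lemma horner_span x : exists P, [/\ fixed P, (size P <= n)%N & x = P.[th]].
Proof.
pose Q (c : {ffun 'I_n -> 'I_p}) : {poly F} :=
  \poly_(i < n) (c (inord i))%:R.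
have QK c : fixed (Q c).
  apply/polyP => i; rewrite coef_map /= coef_poly; case: ifP => _.
    by rewrite pFrobenius_aut_nat.
  by rewrite pFrobenius_aut0.
have Q_inj : injective (fun c => (Q c).[th]).
  move=> c d /eqP; rewrite -subr_eq0 -hornerN -hornerD => /eqP Qcd.
  have cdK : fixed (Q c - Q d) by apply: fixedD => //; apply: fixedN.
  have : Q c - Q d = 0.
    apply: (@roots_geq_poly_eq0 _ _ [seq th ^+ (p ^ j) | j <- iota 0 n]).
    - by apply/allP => _ /mapP[j _ ->]; apply/rootP/horner_conj0.
    - rewrite map_inj_in_uniq ?iota_uniq // => i j;
      rewrite !mem_iota /= => iN jN.
      exact: (conj_inj p_pr cardF n_gt0 thP).
    rewrite size_map size_iota (leq_trans (size_polyD _ _)) // size_polyN.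
    by rewrite geq_max !size_poly.
  move=> cd0; apply/ffunP => i; apply/val_inj.
  apply: (natr_p_inj p_pr cardF (ltn_ord _) (ltn_ord _)).
  have /eqP := congr1 (fun P : {poly F} => P`_i) cd0.
  by rewrite coefB !coef_poly ltn_ord inord_val coef0 subr_eq0 => /eqP.
have /codomP[c ->] : x \in codom (fun c => (Q c).[th]).
  by apply: inj_card_onto; rewrite // card_ffun !card_ord cardF.
by exists (Q c); split => //; exact: size_poly.
Qed.

(** The span of [1, .., th^(k-1)] over the prime field, as a boolean so that it can index sums. *)
Let Wk k x : bool := `[< exists P, [/\ fixed P, (size P <= k)%N & x = P.[th]]
  >].

Lemma WkP k x :
  reflect (exists P, [/\ fixed P, (size P <= k)%N & x = P.[th]]) (Wk k x).
Proof. exact: asboolP. Qed.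

Lemma Wk0 k : Wk k 0.
Proof.
by apply/WkP; exists 0; split; rewrite ?size_poly0 ?horner0 // /fixed rmorph0.
Qed.

Lemma WkD k x1 x2 : Wk k x1 -> Wk k x2 -> Wk k (x1 + x2).
Proof.
move=> /WkP[P [PK sP ->]] /WkP[Q [QK sQ ->]]; apply/WkP; exists (P + Q).
split; rewrite ?hornerD //; first exact: fixedD.
by rewrite (leq_trans (size_polyD _ _)) // geq_max sP.
Qed.

Lemma WkN k x : Wk k x -> Wk k (- x).
Proof.
move=> /WkP[P [PK sP ->]]; apply/WkP; exists (- P).
by split; rewrite ?hornerN ?size_polyN //; exact: fixedN.
Qed.

Lemma Wk_addl k x1 x2 : Wk k x1 -> Wk k (x1 + x2) = Wk k x2.
Proof.
move=> W1; apply/idP/idP; last exact: WkD.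
by move=> /(WkD (WkN W1)); rewrite addKr.
Qed.

Lemma WkM k l x1 x2 : Wk k.+1 x1 -> Wk l.+1 x2 -> Wk (k + l).+1 (x1 * x2).
Proof.
move=> /WkP[P [PK sP ->]] /WkP[Q [QK sQ ->]]; apply/WkP; exists (P * Q).
split; rewrite ?hornerM //; first exact: fixedM.
apply: leq_trans (size_polyMleq _ _) _; lia.
Qed.

Lemma Wk_le k l x : (k <= l)%N -> Wk k x -> Wk l x.
Proof.
move=> kl /WkP[P [PK sP ->]]; apply/WkP; exists P.
by split=> //; apply: leq_trans kl.
Qed.

Lemma Wk_theta k i : (i < k)%N -> Wk k (th ^+ i).
Proof.
move=> ik; apply/WkP; exists 'X^i; split; first exact: fixedXn.
  by rewrite size_polyXn.
by rewrite hornerXn.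
Qed.

Lemma Wk_nat m k : Wk k.+1 m%:R.
Proof.
apply/WkP; exists (m%:R)%:P; rewrite hornerC; split => //.
  by apply: fixedC; apply: (natr_fixed p_pr cardF).
by rewrite (leq_trans (size_polyC_leq1 _)).
Qed.

Lemma Wk_isotropic x : Wk (2 * h) x -> T (x / y) = 0.
Proof.
move=> /WkP[P [PK sP ->]]; rewrite ftrace_horner ?leqW //.
by rewrite nth_default.
Qed.

Lemma Wk0_eq0 x : Wk 0 x -> x = 0.
Proof.
by move=> /WkP[P [_ sP ->]]; move: sP; rewrite leqn0 size_poly_eq0 => /eqP->;
  rewrite horner0.
Qed.

Lemma Wk_prod_isotropic k l x1 x2 : (k + l <= (2 * h).+1)%N ->
  Wk k x1 -> Wk l x2 -> T (x1 * x2 / y) = 0.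
Proof.
case: k => [|k]; first by move=> _ /Wk0_eq0-> _; rewrite mul0r;
  apply: Wk_isotropic;
  exact: Wk0.
case: l => [|l]; first by move=> _ _ /Wk0_eq0->; rewrite mulr0;
  apply: Wk_isotropic;
  exact: Wk0.
move=> kl W1 W2; apply: Wk_isotropic.
by apply: Wk_le (WkM W1 W2); lia.
Qed.

Hypothesis two_neq0 : (2%:R : F) != 0.

Let TM (k l : nat) x1 x2 : (k + l <= n)%N -> Wk k x1 -> Wk l x2 -> T (x1 * x2 /
  y) = 0.
Proof. exact: Wk_prod_isotropic. Qed.

(** [Wk h.+1] is the orthogonal of [Wk h] for the form [T (x * w / y)]; the doubled argument is the
    cross term of [(x + w) ^+ 2 / y]. *)
Lemma Wk_orth x :
  Wk h.+1 x = [forall w, Wk h w ==> (e (x * w / y + x * w / y) == 1)].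
Proof.
have eqT w : (e (x * w / y + x * w / y) == 1) = (T (x * w / y) == 0).
  by rewrite achar_eq1 TD -mulr2n -mulr_natl mulf_eq0 (negPf two_neq0).
apply/idP/forallP => [Wx w|orth].
  apply/implyP => Ww; rewrite eqT; apply/eqP/(TM _ Wx Ww).
  by rewrite /n; lia.
have [P [PK sP xE]] := horner_span x.
apply/WkP; exists P; split=> //; rewrite leqNgt; apply/negP => hP.
have szP : size P = (size P).-1.+1 by rewrite prednK //; lia.
(* This power raises the degree of [P] to exactly [2 h], so that the trace returns its leading
   coefficient. *)
pose w := th ^+ (2 * h - (size P).-1).
have Ww : Wk h w by apply: Wk_theta; lia.
have := orth w; rewrite Ww eqT.
have -> : x * w = (P * 'X^(2 * h - (size P).-1)).[th].
  by rewrite hornerM hornerXn -xE.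
rewrite ftrace_horner; last first.
- by apply: leq_trans (size_polyMleq _ _) _; rewrite size_polyXn; lia.
- exact: fixedM (fixedXn _).
have sP' : ((size P).-1 <= 2 * h)%N by lia.
rewrite coefMXn ifF ?subKn //; last by apply/negP; lia.
have -> : P`_(size P).-1 = lead_coef P by [].
by rewrite /= lead_coef_eq0 -size_poly_eq0 szP.
Qed.

(** The coset of [x] modulo [Wk h] is given by its coefficient of [th ^+ h]. For uniqueness, a
    multiple [d * th ^+ h] in [Wk h] pairs with [th ^+ h] to both 0 and [d]. *)
Lemma Wk_coset x : Wk h.+1 x ->
  exists c : 'I_p, forall c' : 'I_p, Wk h (x - c'%:R * th ^+ h) = (c' == c).
Proof.
move=> Wx; have /WkP[P [PK sP xE]] := Wx.
have [c cE] := fixed_natr p_pr cardF (fixed_coef h PK).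
have Wc : Wk h (x - c%:R * th ^+ h).
  apply/WkP; exists (P - c%:R%:P * 'X^h); split.
  - apply: (fixedD PK); apply: fixedN; apply: fixedM (fixedXn _).
    by apply: fixedC; apply: (natr_fixed p_pr cardF).
  - apply/leq_sizeP => i hi; rewrite coefB coefCM coefXn.
    have [->|ih] := eqVneq i h; first by rewrite cE mulr1 subrr.
    by rewrite mulr0 subr0 nth_default //; apply: leq_trans sP _; lia.
  by rewrite hornerD hornerN hornerM hornerC hornerXn -xE.
exists c => c'; apply/idP/eqP => [Wc'|-> //].
apply/val_inj/(natr_p_inj p_pr cardF (ltn_ord _) (ltn_ord _))/eqP.
rewrite -subr_eq0; set d := _ - _.
have Wd : Wk h (d * th ^+ h).
  have -> : d * th ^+ h = (x - c%:R * th ^+ h) + - (x - c'%:R * th ^+ h).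
    by rewrite /d; ring.
  exact: WkD (WkN _).
have dp : d ^+ p = d.
  rewrite -[d ^+ p]/(frob d) /d rmorphB /= !pFrobenius_autE.
  by rewrite !(natr_fixed p_pr cardF).
have hn : (h + h.+1 <= n)%N by rewrite /n; lia.
have := TM hn Wd (Wk_theta (ltnSn h)).
rewrite -!mulrA TZ // mulrA -exprD T_euler ?addnn -?mul2n // eqxx mulr1.
by move=> ->.
Qed.

(** The square of [w] and the cross term have trace 0, which leaves [c ^ 2] times the trace 1 of
    [th ^+ (2 * h) / y]. *)
Lemma achar_coset (c : nat) w : Wk h w ->
  e ((w + c%:R * th ^+ h) ^+ 2 / y) = zeta ^+ (c ^ 2).
Proof.
move=> Ww; apply: eE; rewrite -/T.
have -> : (w + c%:R * th ^+ h) ^+ 2 / y =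
    w * (w + (c%:R * th ^+ h + c%:R * th ^+ h)) / y
    + (c ^ 2)%:R * (th ^+ (2 * h) / y).
  have -> : th ^+ (2 * h) = th ^+ h * th ^+ h by rewrite -exprD addnn mul2n.
  by rewrite natrX; ring.
have Wc : Wk h.+1 (c%:R * th ^+ h).
  exact: (@WkM 0 h _ _ (Wk_nat c 0) (Wk_theta (ltnSn h))).
have hn : (h + h.+1 <= n)%N by rewrite /n; lia.
rewrite TD (TM hn Ww (WkD (Wk_le (leqnSn h) Ww) (WkD Wc Wc))) add0r.
by rewrite TZ ?(natr_fixed p_pr cardF) // T_euler // eqxx mulr1.
Qed.

Let cardW := #|[pred x | Wk h x]|.

(** Averaging over translations by [w] in [Wk h] multiplies the term of [x] by a character sum over
    [Wk h], which vanishes unless [x] is orthogonal to [Wk h]. *)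
Lemma isotropic_sum_orth :
  \sum_x e (x ^+ 2 / y) = \sum_(x | Wk h.+1 x) e (x ^+ 2 / y).
Proof.
have W0 : (cardW%:R : C) != 0.
  by rewrite pnatr_eq0 -lt0n; apply/card_gt0P; exists 0; exact: Wk0.
apply: (mulfI W0); rewrite mulr_natl -sumr_const.
transitivity (\sum_(w | Wk h w) \sum_x e ((x + w) ^+ 2 / y)).
  apply: eq_big => [x|w _]; first by rewrite inE.
  by rewrite [LHS](reindex_inj (addIr w)).
rewrite exchange_big /= mulr_sumr [RHS]big_mkcond; apply: eq_bigr => x _.
transitivity (e (x ^+ 2 / y) * \sum_(w | Wk h w) e (x * w / y + x * w / y)).
  rewrite mulr_sumr; apply: eq_bigr => w Ww; rewrite -acharD.
  have hn : (h + h <= n)%N by rewrite /n; lia.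
  have /eqP w1 : e (w * w / y) == 1 by rewrite achar_eq1 (TM hn Ww Ww).
  rewrite -[RHS]mulr1 -w1 -acharD; congr e; ring.
rewrite Wk_orth; case: ifPn => [/forallP orth|].
  rewrite (eq_bigr (fun=> 1)) => [|w Ww].
    rewrite mulrC; congr (_ * _); rewrite -[RHS]sumr_const.
    by apply: eq_bigl => w; rewrite inE.
  by apply/eqP; move: (orth w); rewrite Ww.
rewrite negb_forall => /existsP[w0]; rewrite negb_imply => /andP[Ww0 ew0].
suff -> : \sum_(w | Wk h w) e (x * w / y + x * w / y) = 0 by rewrite mulr0.
have d0 : 1 - e (x * w0 / y + x * w0 / y) != 0 by rewrite subr_eq0 eq_sym.
apply: (mulfI d0); rewrite mulr0; apply/eqP.
rewrite mulrBl mul1r subr_eq0 mulr_sumr; apply/eqP.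
rewrite [LHS](reindex_inj (addrI w0)) /=.
apply: eq_big => [w|w _]; first exact: Wk_addl.
by rewrite -acharD; congr e; ring.
Qed.

Lemma isotropic_sum :
  exists2 k : nat, (0 < k)%N &
  \sum_x e (x ^+ 2 / y) = k%:R * \sum_(c < p) zeta ^+ (c ^ 2).
Proof.
exists cardW.
  by apply/card_gt0P; exists 0; exact: Wk0.
rewrite isotropic_sum_orth.
transitivity (\sum_(x | Wk h.+1 x)
    \sum_(c < p | Wk h (x - c%:R * th ^+ h)) e (x ^+ 2 / y)).
  apply: eq_bigr => x /Wk_coset[c cE].
  by rewrite (eq_bigl _ _ cE) big_pred1_eq.
rewrite (exchange_big_dep xpredT) //= mulr_sumr; apply: eq_bigr => c _.
rewrite [RHS]mulr_natl -[RHS]sumr_const [LHS](reindex_inj (addIr (c%:R * th ^+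
  h))).
apply: eq_big => [w|w].
  rewrite inE addrK andb_idl // => Ww; apply: (WkD (Wk_le (leqnSn h) Ww)).
  exact: (@WkM 0 h _ _ (Wk_nat c 0) (Wk_theta (ltnSn h))).
by rewrite addrK => /andP[_ Ww]; rewrite achar_coset.
Qed.

End IsotropicSubspace.

Lemma prod_pair_even (C : comNzRingType) (u : nat -> C) v c :
  (forall k, (k < v)%N -> u k * u (2 * v - k.+1)%N = c) ->
  \prod_(k < 2 * v) u k = c ^+ v.
Proof.
elim: v u => [|v IH] u uc; first by rewrite muln0 big_ord0.
have -> : (2 * v.+1 = (2 * v).+2)%N by lia.
rewrite big_ord_recl big_ord_recr /=.
have -> : \prod_(k < 2 * v) u (bump 0 k) = c ^+ v.
  by apply: (IH (fun k => u k.+1)) => k kv; rewrite -(uc k.+1) //;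
    congr (_ * u _); lia.
rewrite exprS -(uc 0%N) // /bump /=.
have -> : (2 * v.+1 - 1 = 1 + 2 * v)%N by lia.
by ring.
Qed.

(** * The quadratic character and its Gauss sum *)

Section QuadraticChar.
Variables (F : finFieldType) (C : numFieldType) (phi : F -> C) (g : F).
Hypotheses (phiP : is_mchar phi) (gP : (#|F|.-1).-primitive_root g).
Hypothesis phig : phi g = -1.

Lemma quad_sqr x : x != 0 -> phi x ^+ 2 = 1.
Proof.
move=> x0; have [i ->] := finField_prim_rootP gP x0.
by rewrite (mcharX phiP) phig exprAC sqrrN !expr1n.
Qed.

Lemma quad_expr_odd x k : odd k -> x != 0 -> phi (x ^+ k) = phi x.
Proof.
move=> k_odd x0; rewrite (mcharX phiP) -[k]odd_double_half k_odd exprD expr1.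
by rewrite -mul2n exprM quad_sqr // expr1n mulr1.
Qed.

(* [th - th^(p^(n-j))] is carried by the [j]-th Frobenius to
   [-(th - th^(p^j))], and [phi] is Frobenius invariant. *)
Lemma quad_conj_diff p h : prime p -> odd p -> #|F| = (p ^ (2 * h).+1)%N ->
  phi (-1) = -1 -> phi (conj_diff p (2 * h).+1 g) = (-1) ^+ h.
Proof.
move=> p_pr p_odd cardF phiN1.
rewrite (big_morph phi (mcharM phiP) (mchar1 phiP)) /=.
apply: (@prod_pair_even _ (fun j => phi (g - g ^+ (p ^ j.+1)))) => k kh.
have d0 j : (j < 2 * h)%N -> g - g ^+ (p ^ j.+1) != 0.
  move=> jh; have /prodf_neq0/(_ (Ordinal jh) isT) // :=
    conj_diff_neq0 p_pr cardF (ltn0Sn _) gP.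
have odd_pX j : odd (p ^ j) by rewrite oddX p_odd orbT.
have -> : (2 * h - k.+1).+1 = (2 * h - k)%N by lia.
have d1 : g - g ^+ (p ^ (2 * h - k)) != 0.
  have := d0 (2 * h - k.+1)%N; have -> : (2 * h - k.+1).+1 = (2 * h - k)%N by
    lia.
  by apply; lia.
rewrite -(quad_expr_odd (odd_pX k.+1) d1).
have -> : (g - g ^+ (p ^ (2 * h - k))) ^+ (p ^ k.+1) = -1 * (g - g ^+ (p ^
  k.+1)).
  apply: (addIr ((g ^+ (p ^ (2 * h - k))) ^+ (p ^ k.+1))).
  rewrite -(iter_frobD p_pr cardF) subrK -exprM -expnD.
  have -> : (2 * h - k + k.+1 = 0 + (2 * h).+1)%N by lia.
  by rewrite (expf_pX cardF) expn0 expr1; ring.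
rewrite (mcharM phiP) phiN1 mulrCA -expr2 quad_sqr ?mulr1 //.
by apply: d0; lia.
Qed.

Hypothesis two_neq0 : (2%:R : F) != 0.

(** An odd power of [g] has no square root, and a nonzero even power has the two distinct roots [w]
    and [- w]. *)
Lemma quad_count z : \sum_(x | x ^+ 2 == z) (1 : C) = 1 + phi z.
Proof.
have [->|z0] := eqVneq z 0.
  rewrite (mchar0 phiP) addr0 (big_pred1 0) // => x; exact: sqrf_eq0.
have [i zE] := finField_prim_rootP gP z0.
have phiz : phi z = (-1) ^+ i by rewrite zE (mcharX phiP) phig.
have [i_odd|i_even] := boolP (odd i).
  rewrite phiz -signr_odd i_odd expr1 subrr big1 // => x /eqP xz.
  have x0 : x != 0 by apply: contraNneq z0 => x0; rewrite -xz x0 expr0n.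
  have /eqP := quad_sqr x0; rewrite -(mcharX phiP) xz phiz -signr_odd i_odd
    expr1.
  by rewrite eq_sym -addr_eq0 -mulr2n pnatr_eq0.
pose w := g ^+ i./2.
have zw : z = w ^+ 2.
  by rewrite zE -exprM muln2 -[in LHS](odd_double_half i) (negPf i_even).
have ww : w != - w.
  rewrite -addr_eq0 -mulr2n -mulr_natl mulf_neq0 //.
  by rewrite expf_neq0 // (prim_root_neq0 gP).
rewrite phiz -signr_odd (negPf i_even) expr0.
rewrite (eq_bigl (pred2 w (- w))) => [|x]; last by rewrite zw eqf_sqr.
rewrite (bigD1 w) /=; last by rewrite eqxx.
rewrite (big_pred1 (- w)) // => x /=; case: (eqVneq x w) => [->|];
  rewrite ?andbT //=.
by rewrite (negPf ww).
Qed.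

Variable e : F -> C.
Hypotheses (eD : forall x y, e (x + y) = e x * e y) (e0 : e 0 = 1).
Hypothesis e_nontrivial : exists x, e x != 1.

(** Grouping by [z = x ^+ 2] gives the weight [1 + phi z], whose constant part sums to 0; the
    substitution [z = x * b] then brings out [phi b]. *)
Lemma quad_gauss_sum b : b != 0 ->
  \sum_x e (x ^+ 2 / b) = phi b * \sum_x phi x * e x.
Proof.
move=> b0; have bV : b^-1 != 0 by rewrite invr_eq0.
transitivity (\sum_z (1 + phi z) * e (z / b)).
  rewrite (partition_big (fun x => x ^+ 2) xpredT) //=; apply: eq_bigr => z _.
  rewrite -quad_count mulr_suml; apply: eq_bigr => x /eqP <-; by rewrite mul1r.
under eq_bigr do rewrite mulrDl mul1r.
have -> : \sum_z (e (z / b) + phi z * e (z / b)) = \sum_z phi z * e (z / b).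
  rewrite big_split /= [X in X + _](_ : _ = 0) ?add0r //.
  rewrite -[RHS](achar_sum0 eD e_nontrivial) [RHS](reindex_inj (mulIf bV)).
  by apply: eq_bigr.
rewrite mulr_sumr (reindex_inj (mulIf b0)) /=.
apply: eq_bigr => x _; rewrite mulfK // (mcharM phiP); ring.
Qed.

Lemma quad_gauss_sqr : phi (-1) = -1 -> (\sum_x phi x * e x) ^+ 2 = - #|F|%:R.
Proof.
move=> phiN1; rewrite expr2 (gauss_inv eD e0 e_nontrivial phiP phiP).
- by rewrite phiN1 mulN1r.
- move=> x; have [->|x0] := eqVneq x 0; first by rewrite (mchar0 phiP) mul0r.
  by rewrite -expr2 quad_sqr.
by exists g; rewrite ?(prim_root_neq0 gP) // phig eq_sym -addr_eq0 -mulr2n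
  pnatr_eq0.
Qed.

End QuadraticChar.

(** * The Gauss sum over the prime field *)

(** Gaussian binomials through their Pascal rule, which makes sense at roots of unity, where the
    quotient formula may be 0 over 0. *)
Fixpoint qbin (C : comNzRingType) (x : C) (n k : nat) : C :=
  match n, k with
  | _, 0 => 1
  | 0, _.+1 => 0
  | n'.+1, k'.+1 => qbin x n' k'.+1 + x ^+ (n' - k') * qbin x n' k'
  end.

Section QBinomial.
Variables (C : comNzRingType) (x : C).

Lemma qbinS n k :
  qbin x n.+1 k.+1 = qbin x n k.+1 + x ^+ (n - k) * qbin x n k.
Proof. by []. Qed.

Lemma qbin0 n : qbin x n 0 = 1.
Proof. by case: n. Qed.

Lemma qbin_small n k : (n < k)%N -> qbin x n k = 0.
Proof.
elim: n k => [|n IH] [|k] // nk.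
by rewrite qbinS !IH ?mulr0 ?addr0 // ltnW.
Qed.

(** The ratios of neighbouring Gaussian binomials, with denominators cleared so as to hold for every
    [x]. *)
Lemma qbin_step n k : (k <= n)%N ->
  (1 - x ^+ k.+1) * qbin x n k.+1 = (1 - x ^+ (n - k)) * qbin x n k
  /\ (1 - x ^+ (n.+1 - k)) * qbin x n.+1 k = (1 - x ^+ n.+1) * qbin x n k.
Proof.
elim: n k => [|n IH] k kn.
  by move: kn; rewrite leqn0 => /eqP->;
    rewrite /= subn0 expr0 subrr mulr0 mul0r.
have down j : (j <= n.+1)%N ->
    (1 - x ^+ j.+1) * qbin x n.+1 j.+1 = (1 - x ^+ (n.+1 - j)) * qbin x n.+1 j.
  rewrite leq_eqVlt => /predU1P[->|];
    first by rewrite qbin_small // subnn expr0; ring.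
  rewrite ltnS => jn; have [E1 ->] := IH _ jn.
  rewrite qbinS mulrDr E1.
  have -> : x ^+ n.+1 = x ^+ (n - j) * x ^+ j.+1 by rewrite -exprD;
    congr (_ ^+ _); lia.
  ring.
split; first exact: down.
case: k kn => [|k] kn; first by rewrite !qbin0 subn0.
have {}kn : (k < n.+1)%N by [].
rewrite qbinS mulrDr subSS.
have E1 := down k (ltnW kn).
rewrite -[X in _ + X = _]mulrCA.
have -> : x ^+ n.+2 = x ^+ (n.+1 - k) * x ^+ k.+1 by rewrite -exprD;
  congr (_ ^+ _); lia.
rewrite -E1; ring.
Qed.

Definition qbin_alt n := \sum_(k < n.+1) (-1) ^+ k * qbin x n k.

(** The Pascal rule first gives each term of row [m] the factor [1 - x ^+ (m - k)]. For [m = n + 1]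
    the second ratio identity turns this into the common factor [1 - x ^+ n.+1]. *)
Lemma qbin_alt_rec n : qbin_alt n.+2 = (1 - x ^+ n.+1) * qbin_alt n.
Proof.
have step m : qbin_alt m.+1 = \sum_(k < m.+1) (-1) ^+ k * ((1 - x ^+ (m - k)) *
  qbin x m k).
  transitivity (qbin_alt m - \sum_(k < m.+1) (-1) ^+ k * (x ^+ (m - k) * qbin x
    m k)).
    rewrite /qbin_alt big_ord_recl /= expr0 mul1r.
    under eq_bigr do rewrite /bump /= add1n mulrDr exprS !mulN1r.
    rewrite big_split /= [X in _ + (_ + X)](_ : _ =
      - \sum_(k < m.+1) (-1) ^+ k * (x ^+ (m - k) * qbin x m k)); last first.
      by rewrite -sumrN; apply: eq_bigr => k _; rewrite mulNr.
    rewrite addrA; congr (_ - _).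
    rewrite big_ord_recr /= qbin_small // mulr0 addr0 [RHS]big_ord_recl /=
      expr0 mul1r qbin0.
    by congr (_ + _); apply: eq_bigr => k _;
      rewrite /bump /= add1n exprS mulN1r.
  rewrite /qbin_alt -sumrB; apply: eq_bigr => k _; ring.
rewrite step big_ord_recr /= subnn expr0 subrr mul0r mulr0 addr0 mulr_sumr.
apply: eq_bigr => k _; have [_ ->] := @qbin_step n k (ltn_ord k); ring.
Qed.

Lemma qbin_alt_even m : qbin_alt (2 * m) = \prod_(k < m) (1 - x ^+ (2 * k).+1).
Proof.
elim: m => [|m IH]; first by rewrite muln0 /qbin_alt big_ord1 big_ord0 expr0
  mul1r.
have -> : (2 * m.+1 = (2 * m).+2)%N by lia.
by rewrite qbin_alt_rec IH big_ord_recr mulrC.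
Qed.

End QBinomial.

(* Gauss's evaluation: at a primitive [p]-th root of unity the Gaussian
   binomials [p-1 choose k] are themselves roots of unity up to sign. *)
Lemma gauss_sum_prod (C : fieldType) (p m : nat) (w : C) :
  prime p -> p = (2 * m).+1 -> p.-primitive_root w ->
  \sum_(c < p) w ^+ (c ^ 2) =
    \prod_(k < m) (w ^+ (2 * k).+1 - (w ^+ (2 * k).+1)^-1).
Proof.
(* At the base [w^-2], the signed binomials of row [p - 1] become [w ^+ (k * k.+1)]. *)
move=> p_pr pE wP; pose x := (w ^+ 2)^-1.
have wp : w ^+ p = 1 := prim_expr_order wP.
have w0 : w != 0.
  apply/eqP => w0; move/eqP: wp.
  by rewrite w0 expr0n gtn_eqF ?prime_gt0 // eq_sym oner_eq0.
have qE k : (k <= 2 * m)%N -> qbin x (2 * m) k = (-1) ^+ k * w ^+ (k * k.+1).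
  elim: k => [|k IH] km; first by rewrite qbin0 mul0n !expr0 mulr1.
  have [E _] := @qbin_step _ x (2 * m) k (ltnW km).
  pose u := w ^+ (2 * k.+1).
  have u0 : u != 0 by rewrite expf_neq0.
  have xu : x ^+ k.+1 = u^-1 by rewrite /x exprVn -exprM.
  have xu' : x ^+ (2 * m - k) = u.
    apply: (mulIf (expf_neq0 k.+1 (_ : x != 0))).
      by rewrite invr_eq0 expf_neq0.
    rewrite -exprD xu divff //.
    have -> : (2 * m - k + k.+1 = p)%N by lia.
    by rewrite /x exprVn exprAC wp expr1n invr1.
  have u1 : 1 - u^-1 != 0.
    rewrite subr_eq0 eq_sym invr_eq1 -(prim_order_dvd wP) Euclid_dvdM //.
    by rewrite !gtnNdvd //; lia.
  apply: (mulfI u1); rewrite -xu E xu' xu IH 1?ltnW // exprS.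
  have -> : w ^+ (k.+1 * k.+2) = w ^+ (k * k.+1) * u.
    by rewrite -exprD; congr (_ ^+ _); lia.
  by field.
have sumE : \sum_(c < p) w ^+ (c * c.+1) = \prod_(k < m) (1 - x ^+ (2 * k).+1).
  rewrite -qbin_alt_even /qbin_alt -pE; apply: eq_bigr => k _.
  rewrite qE; last by have := ltn_ord k; lia.
  by rewrite mulrA -expr2 exprAC sqrrN !expr1n mul1r.
have hp k : w ^+ ((k + p) ^ 2) = w ^+ (k ^ 2).
  have -> : ((k + p) ^ 2 = k ^ 2 + p * (2 * k + p))%N by ring.
  by rewrite exprD exprM wp expr1n mulr1.
(* Completing the square: [2 (m + 1)] is 1 modulo [p], so the shift by [m + 1] turns [c ^ 2] into
   [c (c + 1)] plus a constant. *)
have -> : \sum_(c < p) w ^+ (c ^ 2) = w ^+ (m.+1 ^ 2) * \sum_(c < p) w ^+ (c *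
  c.+1).
  rewrite -(big_shift _ m.+1 hp) mulr_sumr; apply: eq_bigr => k _.
  have -> : ((k + m.+1) ^ 2 = m.+1 ^ 2 + k * k.+1 + p * k)%N.
    by move: (k : nat) => j; rewrite pE; ring.
  by rewrite !exprD [w ^+ (p * _)]exprM wp expr1n mulr1.
rewrite sumE.
(* Modulo [p] the exponent is [m ^ 2], the sum of the first [m] odd numbers, so each factor receives
   one of them. *)
have -> : w ^+ (m.+1 ^ 2) = \prod_(k < m) w ^+ (2 * k).+1.
  have -> : (m.+1 ^ 2 = m ^ 2 + p)%N by rewrite pE; ring.
  rewrite exprD wp mulr1; elim: (m) => [|k IH]; first by rewrite big_ord0.
  rewrite big_ord_recr /= -IH -exprD; congr (_ ^+ _); ring.
rewrite -big_split; apply: eq_bigr => k _ /=.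
rewrite mulrBr mulr1; congr (_ - _).
have c0 : w ^+ (2 * k).+1 != 0 by rewrite expf_neq0.
by rewrite /x exprVn exprAC expr2 invfM mulrA divff // mul1r.
Qed.

(** * Complex roots of unity and the sign of the Gauss sum over the prime field *)

Section RootsOfUnity.
Variable R : realType.
Implicit Types N k : nat.

Let angle N k : R := k%:R * (2 * pi / N%:R).

Lemma zeta_pX N k : zeta_p R N ^+ k = cos (angle N k) +i* sin (angle N k).
Proof.
elim: k => [|k IH]; first by rewrite expr0 /angle mul0r cos0 sin0.
rewrite exprS IH /zeta_p; set t := 2 * pi / N%:R.
have -> : angle N k.+1 = t + angle N k by rewrite /angle -/t -natr1; ring.
rewrite cosD sinD; apply/eqP; rewrite eq_complex /=; apply/andP; split=> //.
by apply/eqP; ring.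
Qed.

Lemma zeta_p_eq1 N : (0 < N)%N -> zeta_p R N ^+ N = 1.
Proof.
move=> N0; rewrite zeta_pX.
have -> : angle N N = pi *+ 2.
  rewrite /angle mulrC divfK ?pnatr_eq0 -?lt0n // mulr_natl.
  by [].
by rewrite cos2pi sin2pi.
Qed.

Lemma zeta_p_neq1 N k : (0 < k < N)%N -> zeta_p R N ^+ k != 1.
Proof.
move=> /andP[k0 kN]; rewrite zeta_pX eq_complex /=.
have N0 : (0 < N%:R :> R) by rewrite ltr0n (leq_ltn_trans _ kN).
(* The half angle lies strictly between 0 and pi, where the sine is positive; [cos (2 t) = 1] would
   force it to be 0. *)
pose t : R := k%:R * pi / N%:R.
have -> : angle N k = t *+ 2 by rewrite /angle /t -mulr_natl; ring.
have : 0 < sin t.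
  apply: sin_gt0_pi; apply/andP; split.
    by rewrite divr_gt0 // mulr_gt0 ?pi_gt0 // ltr0n.
  by rewrite ltr_pdivrMr // mulrC ltr_pM2l ?pi_gt0 // ltr_nat.
move=> st; apply/negP => /andP[/eqP c1 _].
have := cos2Dsin2 t; rewrite cos_mulr2n in c1.
have sq : 0 < sin t ^+ 2 by rewrite exprn_gt0.
move=> cs; move: sq; have -> : sin t ^+ 2 = 0.
  by move: c1 cs; move: (cos t ^+ 2) (sin t ^+ 2) => a b; rewrite mulr2n; lra.
by rewrite ltxx.
Qed.

Lemma zeta_p_prim N : (0 < N)%N -> N.-primitive_root (zeta_p R N).
Proof.
move=> N0; have [m mP mN] := prim_order_exists N0 (zeta_p_eq1 N0).
have := dvdn_leq N0 mN; rewrite leq_eqVlt => /predU1P[mE|mltN].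
  by rewrite -{1}mE.
have := @zeta_p_neq1 N m; rewrite (prim_order_gt0 mP) mltN => /(_ isT).
by rewrite (prim_expr_order mP) eqxx.
Qed.

Lemma zeta_p_subV N k : zeta_p R N ^+ k - (zeta_p R N ^+ k)^-1
  = 'i * (2 * sin (angle N k))%:C.
Proof.
rewrite zeta_pX; set t := angle N k.
have -> : (cos t +i* sin t)^-1 = cos t -i* sin t.
  have d0 : cos t +i* sin t != 0.
    rewrite eq_complex /=; apply/negP => /andP[/eqP c0 /eqP s0].
    by have /eqP := cos2Dsin2 t; rewrite c0 s0 expr0n addr0 eq_sym oner_eq0.
  apply: (mulfI d0); rewrite divff //; apply/esym/eqP; rewrite eq_complex /=.
  by rewrite mulrN opprK -!expr2 cos2Dsin2 eqxx mulrN mulrC addNr eqxx.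
apply/eqP; rewrite eq_complex /=; apply/andP; split; apply/eqP; ring.
Qed.

Lemma sin_angle_gt0 N k : (0 < k)%N -> (2 * k < N)%N -> 0 < sin (angle N k).
Proof.
move=> k0 kN; have N0 : (0 < N%:R :> R) by rewrite ltr0n (leq_ltn_trans _ kN).
have -> : angle N k = (2 * k)%:R * pi / N%:R by rewrite /angle natrM; ring.
apply: sin_gt0_pi; apply/andP; split.
  by rewrite divr_gt0 // mulr_gt0 ?pi_gt0 // ltr0n muln_gt0.
by rewrite ltr_pdivrMr // mulrC ltr_pM2l ?pi_gt0 // ltr_nat.
Qed.

Lemma sin_angle_lt0 N k : (k < N)%N -> (N < 2 * k)%N -> sin (angle N k) < 0.
Proof.
move=> kN Nk; have N0 : (0 < N%:R :> R) by rewrite ltr0n (leq_ltn_trans _ kN).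
have -> : angle N k = (2 * k - N)%:R * pi / N%:R + pi.
  rewrite /angle natrB ?(ltnW Nk) // natrM; field.
  by rewrite gt_eqF.
rewrite sinDpi oppr_lt0; apply: sin_gt0_pi; apply/andP; split.
  by rewrite divr_gt0 // mulr_gt0 ?pi_gt0 // ltr0n subn_gt0.
rewrite ltr_pdivrMr // mulrC ltr_pM2l ?pi_gt0 // ltr_nat; lia.
Qed.

(** With [p = 4 u + 3], the first [u + 1] sines are positive and the last [u] negative. Their sign
    [(-1)^u] cancels against ['i ^+ (2 u + 1) = 'i (-1)^u]. *)
Lemma gauss_sum_sign p : prime p -> (p %% 4 = 3)%N ->
  exists2 t : R, 0 < t & \sum_(c < p) zeta_p R p ^+ (c ^ 2) = 'i * t%:C.
Proof.
move=> p_pr p3; set u := (p %/ 4)%N.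
have pE : p = (2 * (u.+1 + u)).+1 by rewrite /u; lia.
rewrite (gauss_sum_prod p_pr pE (zeta_p_prim (prime_gt0 p_pr))).
pose s k : R := 2 * sin (angle p (2 * k).+1).
rewrite (eq_bigr (fun k : 'I_(u.+1 + u) => 'i * (s k)%:C)) => [|k _];
  last first.
  exact: zeta_p_subV.
rewrite big_split_ord /=.
exists ((\prod_(k < u.+1) s k) * \prod_(k < u) - s (u.+1 + k)%N).
  apply: mulr_gt0; apply: prodr_gt0 => k _; have kb := ltn_ord k.
    by rewrite mulr_gt0 // sin_angle_gt0 //; lia.
  by rewrite oppr_gt0 pmulr_rlt0 // sin_angle_lt0 //; lia.
move: s => f.
have -> : \prod_(k < u) - f (u.+1 + k)%N = (-1) ^+ u * \prod_(k < u) f (u.+1 +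
  k)%N.
  under eq_bigr do rewrite -mulN1r.
  by rewrite big_split /= prodr_const card_ord.
rewrite !big_split /= !prodr_const !card_ord !rmorphM /= !rmorph_prod.
have -> : ((-1) ^+ u)%:C = 'i ^+ u * 'i ^+ u :> R[i].
  by rewrite -exprMn -expr2 sqr_i rmorphXn rmorphN1.
by rewrite exprS; ring.
Qed.

End RootsOfUnity.

(** * The quadratic Gauss sum *)

Section AddChar.
Variables (R : realType) (F : finFieldType) (p n : nat).
Hypotheses (p_pr : prime p) (cardF : #|F| = (p ^ n)%N).

(** Any natural lift of the trace may serve as exponent, since [zeta_p] has order [p]; the default
    value 0 in [addchar] is then never reached. *)
Lemma addchar_natE (x : F) m : m%:R = ftrace p n x -> addchar R p n x = zeta_p
  R p ^+ m :> R[i].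
Proof.
move=> mx; rewrite /addchar; have p0 := prime_gt0 p_pr.
have charF := char_of_card p_pr cardF.
case: pickP => [k /eqP kE|/(_ (Ordinal (ltn_pmod m p0)))] /=; last first.
  by rewrite (GRing.natr_mod_pchar charF) mx eqxx.
rewrite -(prim_expr_mod (zeta_p_prim R p0) m); congr (_ ^+ _).
apply: (natr_p_inj p_pr cardF (ltn_ord k) (ltn_pmod m p0)).
by rewrite (GRing.natr_mod_pchar charF) kE mx.
Qed.

End AddChar.

Section QuadraticGaussSum.
Variables (R : realType) (F : finFieldType) (p h : nat) (phi : F -> R[i]) (g :
  F).
Let n := (2 * h).+1.
Hypotheses (p_pr : prime p) (p3 : (p %% 4 = 3)%N) (cardF : #|F| = (p ^ n)%N).
Hypotheses (phiP : is_mchar phi) (gP : (#|F|.-1).-primitive_root g).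
Hypotheses (phig : phi g = -1) (phiN1 : phi (-1) = -1).

Let p_odd : odd p. Proof. lia. Qed.
Let e := @addchar R F p n.
Let zP := zeta_p_prim R (prime_gt0 p_pr).
Let eE (x : F) m : m%:R = ftrace p n x -> e x = zeta_p R p ^+ m.
Proof. exact: addchar_natE. Qed.

Lemma addcharD (x y : F) : e (x + y) = e x * e y.
Proof. exact: (acharD p_pr cardF eE). Qed.

Lemma addchar0 : e 0 = 1.
Proof.
apply/eqP; rewrite (achar_eq1 p_pr cardF zP eE).
by have /eqP := ftraceD p_pr cardF 0 0; rewrite addr0 eq_sym -subr_eq0 addrK.
Qed.

Lemma addchar_nontrivial : exists x, e x != 1.
Proof.
exists (g ^+ (2 * h) / conj_diff p n g); rewrite (achar_eq1 p_pr cardF zP eE).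
by rewrite (ftrace_euler p_pr cardF (ltn0Sn _) gP) // eqxx oner_eq0.
Qed.

Lemma quad_gauss_value : gauss p n phi = 'i ^+ n * (Num.sqrt (#|F|%:R : R))%:C.
Proof.
have [k k0 kE] := isotropic_sum p_pr cardF gP zP eE (natr2_neq0 p_pr cardF
  p_odd).
have [t t0 tE] := gauss_sum_sign R p_pr p3.
have y0 := conj_diff_neq0 p_pr cardF (ltn0Sn _) gP.
have := quad_gauss_sum phiP gP phig (natr2_neq0 p_pr cardF p_odd) addcharD
  addchar_nontrivial y0.
rewrite kE tE (quad_conj_diff phiP gP phig p_pr p_odd cardF phiN1) -/(gauss p n
  phi) => GE.
have i2h : 'i ^+ (2 * h) = (-1) ^+ h :> R[i] by rewrite exprM sqr_i.
have sgn2 : (-1) ^+ h * (-1) ^+ h = 1 :> R[i] by rewrite -expr2 exprAC sqrrN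
  !expr1n.
have G1 : gauss p n phi = 'i ^+ n * (k%:R * t)%:C.
  transitivity ((-1) ^+ h * (k%:R * ('i * t%:C)) : R[i]).
    by rewrite GE mulrA sgn2 mul1r.
  by rewrite exprS i2h rmorphM rmorph_nat; ring.
(* The sum is now a positive multiple of ['i ^+ n]; comparing squares identifies the multiple as the
   root of [#|F|]. *)
have := quad_gauss_sqr phiP gP phig addcharD addchar0 addchar_nontrivial phiN1.
rewrite -/(gauss p n phi) G1 exprMn exprAC sqr_i -signr_odd /n /= mul2n
  odd_double.
rewrite expr1 mulN1r => /oppr_inj;
  rewrite -rmorphXn -(rmorph_nat (real_complex R)).
move=> /complexI <-; rewrite sqrtr_sqr ger0_norm //.
by rewrite mulr_ge0 // ltW.
Qed.

End QuadraticGaussSum.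

(** * The determinant formula and the singular case for the field of [q] elements *)

Lemma expn_mod4_eq3 p n : odd p -> (p ^ n %% 4 = 3)%N -> (p %% 4 = 3)%N /\ odd
  n.
Proof.
move=> p_odd; rewrite -modnXm.
have [->|->] : (p %% 4 = 1)%N \/ (p %% 4 = 3)%N by lia.
  by rewrite exp1n.
move=> E; split=> //; apply: contra_eqT E => n_even.
by rewrite -[n]odd_double_half (negPf n_even) -mul2n expnM -modnXm exp1n.
Qed.

Theorem theorem1p1 (R : realType) (F : finFieldType) (q p n : nat)
  (chi : F -> R[i]) (r : nat) :
  prime p -> odd p -> (0 < n)%N -> q = (p ^ n)%N -> #|F| = q ->
  is_mchar_generator chi -> (1 <= r <= q - 2)%N ->
  (* (i) *)
  ((q %% 4 = 3)%N ->
   forall a : 'I_((q - 1) %/ 2) -> F,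
     injective a -> [set a i | i : 'I_((q - 1) %/ 2)] = Dset F 2 ->
     \det (Bmat (mchar_pow chi r) a)
       = \prod_(k < (q - 1) %/ 2) jacobi (mchar_pow chi r) (mchar_pow chi (2 * k))
     /\
     \prod_(k < (q - 1) %/ 2) jacobi (mchar_pow chi r) (mchar_pow chi (2 * k))
       = (if odd r then
            (-1) ^+ ((q - 3) %/ 4) * (0 +i* 1) ^+ n
              * gauss p n (mchar_pow chi r) ^+ ((q - 1) %/ 2)
              / (Num.sqrt (q%:R : R))%:C
          else
            gauss p n (mchar_pow chi r) ^+ ((q - 1) %/ 2) / q%:R))
  /\
  (* (ii) *)
  (forall k : nat, (k %| q - 1)%N -> (1 < k < q - 1)%N -> ~~ odd ((q - 1) %/ k) ->
   forall a : 'I_((q - 1) %/ k) -> F,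
     injective a -> [set a i | i : 'I_((q - 1) %/ k)] = Dset F k ->
     \det (Bmat (mchar_pow chi r) a) = 0).
Proof.
move=> p_pr p_odd n0 qE cardq chi_gen rq.
have cardF : #|F| = (p ^ n)%N by rewrite cardq.
have chiP : is_mchar chi by case: chi_gen.
have [g gP] := finField_prim_root F.
have N0 : (0 < #|F|.-1)%N := prim_order_gt0 gP.
have cgP := mchar_generator_prim chi_gen gP (zeta_p_prim R N0).
have NE : #|F|.-1 = (q - 1)%N by rewrite cardq subn1.
have two0 := natr2_neq0 p_pr cardF p_odd.
split; last first.
  move=> k kq _ ev a _ aD.
  by apply: (det_Bmat_eq0 (mchar_pow chi r) gP two0 _ _ aD); rewrite NE.
move=> q3 a a_inj aD.
pose v := ((q - 3) %/ 4)%N.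
have mE : ((q - 1) %/ 2 = (2 * v).+1)%N by rewrite /v; lia.
have NE2 : #|F|.-1 = (2 * ((q - 1) %/ 2))%N by rewrite NE; lia.
have NE4 : #|F|.-1 = (2 * (2 * v).+1)%N by rewrite -mE.
split.
  apply: (det_Bmat_squares chiP gP cgP (mchar_powP r chiP) two0 _ NE2 a_inj aD).
  by rewrite mE /= mul2n odd_double.
have [p3 n_odd] : (p %% 4 = 3)%N /\ odd n by apply: expn_mod4_eq3; rewrite -?qE.
have [h nE] : exists h, n = (2 * h).+1.
  by exists n./2; rewrite -[LHS]odd_double_half n_odd mul2n.
subst n.
have card0 : #|F|%:R != 0 :> R[i] by rewrite pnatr_eq0 cardq; lia.
rewrite -/v mE.
have eD := addcharD R p_pr cardF; have e0 := addchar0 R p_pr cardF.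
have e1 := addchar_nontrivial R p_pr cardF gP.
case: ifPn => r_odd; last first.
  have rN : (0 < r < #|F|.-1)%N by rewrite NE; lia.
  by rewrite (jacobi_prod_even chiP gP cgP eD e0 e1 card0 two0 NE4) // cardq.
rewrite (jacobi_prod_odd chiP gP cgP eD e0 e1 card0 two0 NE4 r_odd).
(* The exponent is half of [q - 1], so [phi] is the quadratic character. *)
pose phi := mchar_pow chi (2 * v).+1.
have phiP : is_mchar phi by exact: mchar_powP.
have phig : phi g = -1.
  have g0 := prim_root_neq0 gP; rewrite /phi (mchar_powE _ _ g0).
  have /eqP : (chi g ^+ (2 * v).+1) ^+ 2 = 1.
    by rewrite -exprM mulnC -NE4 (prim_expr_order cgP).
  rewrite sqrf_eq1 -(prim_order_dvd cgP) NE4 gtnNdvd //=; last by lia.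
  by move/eqP.
have phiN1 : phi (-1) = -1.
  rewrite /phi mchar_powE ?oppr_eq0 ?oner_eq0 // (mcharN1 chiP gP cgP two0).
  by rewrite -signr_odd /= mul2n odd_double.
have := quad_gauss_value p_pr p3 cardF phiP gP phig phiN1.
rewrite /gauss /= -/phi => ->; rewrite -[0 +i* 1]/('i).
rewrite cardq.
have ww : 'i ^+ (2 * h).+1 * 'i ^+ (2 * h).+1 = -1 :> R[i].
  by rewrite -exprMn -expr2 sqr_i -signr_odd /= mul2n odd_double.
have w0 : 'i ^+ (2 * h).+1 != 0 :> R[i].
  by apply/eqP => w0; move/eqP: ww; rewrite w0 mul0r eq_sym oppr_eq0 oner_eq0.
(* For odd [n] the inverse of ['i ^+ n] is its negative, which absorbs the minus sign in the product
   of Jacobi sums. *)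
have wV : ('i ^+ (2 * h).+1)^-1 = - 'i ^+ (2 * h).+1 :> R[i].
  by apply: (mulfI w0); rewrite divff // mulrN ww opprK.
rewrite invfM wV; ring.
Qed.
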